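(* Fix an integer $m\ge1$ and $\rho_0>0$. For small real $\delta$, let $\Omega=\Omega_\delta$ be the domain bounded by the curve $\theta\mapsto e^{\rho_0}(e^{i\theta}+\delta e^{-im\theta})$. Then, as $\delta\to0$, the Neumann-Poincaré operator $\mathcal{K}_\Omega^*$ on $V_c$ has eigenvalues and associated eigenfunctions with the following asymptotic expansions, where the eigenvalues are given up to order $\delta$ (error $O(\delta^2)$) and the eigenfunctions up to order $\delta^0$ (error $O(\delta)$). (i) If $m$ is odd, $m=2k-1$ with $k\in\mathbb{N}$: the eigenvalue $\frac{\delta}{2}k+O(\delta^2)$ with eigenfunction $v_k^c+O(\delta)$; and, for each $1\le j\le k-1$ and each choice of sign, the eigenvalue $\pm\frac{\delta}{2}\sqrt{j(m+1-j)}+O(\delta^2)$ with eigenfunction $\sqrt{j}\,v_j^c\pm\sqrt{m+1-j}\,v_{m+1-j}^c+O(\delta)$. (ii) If $m$ is even, $m=2k$ with $k\in\mathbb{N}$: for each $1\le j\le k$ and each choice of sign, the eigenvalue $\pm\frac{\delta}{2}\sqrt{j(m+1-j)}+O(\delta^2)$ with eigenfunction $\sqrt{j}\,v_j^c\pm\sqrt{m+1-j}\,v_{m+1-j}^c+O(\delta)$.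
   Context: Identify $\mathbb{R}^2$ with $\mathbb{C}$. For a bounded domain $\Omega$ with smooth boundary and outward unit normal $\nu$, the Neumann-Poincaré operator on $L^2(\partial\Omega)$ is $$\mathcal{K}_\Omega^*[\varphi](x)=\frac1{2\pi}\int_{\partial\Omega}\frac{\langle x-y,\nu_x\rangle}{|x-y|^2}\varphi(y)\,d\sigma(y),\qquad x\in\partial\Omega.$$ The domain $\Omega_\delta$ arises from the conformal map $\Phi(\zeta)=\zeta+a\zeta^{-m}$ with $a=e^{(m+1)\rho_0}\delta\in\mathbb{R}$, assumed injective on $\{|\zeta|>1\}$ (which holds for $|\delta|$ small). Its boundary is $\partial\Omega=\{\Phi(e^{\rho_0+i\theta}):\theta\in[0,2\pi)\}$, and the complement of $\overline\Omega$ is $\Phi(\{|\zeta|>e^{\rho_0}\})$. On $\partial\Omega$, parametrized by $\theta$, let $J=J(\theta)=\left|\partial_\xi\big(\Phi(e^{\xi})\big)\big|_{\xi=\rho_0+i\theta}\right|=e^{\rho_0}|e^{i\theta}-m\delta e^{-im\theta}|$, so that $d\sigma=J\,d\theta$. Define functions on $\partial\Omega$ by $v_n^c=J^{-1}\cos n\theta$ for $n\ge1$, and let $V_c=\mathrm{span}\{v_1^c,v_2^c,\dots\}$ (closed span in $L^2(\partial\Omega)$). The error terms for eigenfunctions are measured in $L^2(\partial\Omega)$; eigenfunctions are determined up to normalization. *)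

(* Defs.v *)
From HB Require Import structures.
From mathcomp Require Import all_boot all_order all_algebra.
From mathcomp Require Import all_classical all_reals all_analysis.
From mathcomp Require Import measurable_realfun.

Set Implicit Arguments.
Unset Strict Implicit.
Unset Printing Implicit Defensive.

Import Order.TTheory GRing.Theory Num.Theory.
Import numFieldNormedType.Exports.

Local Open Scope classical_set_scope.
Local Open Scope ring_scope.

(* The plane is R * R.  A closed curve is given by a parametrization
   gamma : R -> R * R over one period [0, 2 pi[, and a function on the curve is
   represented by the corresponding function of the parameter. *)

Section curves.
Context {R : realType}.
Implicit Types (gamma : R -> R * R) (u v : R * R).

Definition dotp u v : R := u.1 * v.1 + u.2 * v.2.

Definition velocity gamma (t : R) : R * R :=
  (derive1 (fun s => (gamma s).1) t, derive1 (fun s => (gamma s).2) t).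

Definition speed gamma (t : R) : R :=
  Num.sqrt (dotp (velocity gamma t) (velocity gamma t)).

(* The tangent rotated by - pi / 2: this is the outward normal of the domain
   enclosed by gamma when gamma is a simple closed curve run counterclockwise. *)
Definition outward_normal gamma (t : R) : R * R :=
  ((velocity gamma t).2 / speed gamma t, - (velocity gamma t).1 / speed gamma t).

(* <x - y, nu_x> / |x - y|^2 at x = gamma t, y = gamma s.  On the diagonal the
   quotient is 0 / 0 = 0, which does not matter under the integral. *)
Definition NP_kernel gamma (t s : R) : R :=
  let w := ((gamma t).1 - (gamma s).1, (gamma t).2 - (gamma s).2) in
  dotp w (outward_normal gamma t) / dotp w w.

End curves.

Section boundary.
Context {R : realType} (rho0 : R) (m : nat) (d : R).

(* exp(rho0) * (exp(i t) + d * exp(- i m t)) in real coordinates; for small d it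
   runs counterclockwise, being the image of the circle |zeta| = exp(rho0) under
   the conformal map zeta + a * zeta^(-m), a = exp((m + 1) * rho0) * d. *)
Definition bdry (t : R) : R * R :=
  (expR rho0 * (cos t + d * cos (m%:R * t)),
   expR rho0 * (sin t - d * sin (m%:R * t))).

Definition J (t : R) : R := speed bdry t.

Definition period : set R := `[0, 2 * pi[%classic.

(* Arc length, J dt on one period. *)
Definition sigma (A : set (measurableTypeR R)) : \bar R :=
  (\int[lebesgue_measure]_(t in A `&` period) (J t)%:E)%E.

Lemma velocity_bdry (t : R) : velocity bdry t =
  (expR rho0 * (- sin t - d * m%:R * sin (m%:R * t)),
   expR rho0 * (cos t - d * m%:R * cos (m%:R * t))).
Proof.
have dm : is_derive t 1 (fun s : R => m%:R * s) (m%:R : R).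
  by have := is_deriveZ m%:R (is_derive_id t (1 : R)); rewrite /GRing.scale /= mulr1.
have dcos := is_derive1_comp (is_derive_cos (m%:R * t)) dm.
have dsin := is_derive1_comp (is_derive_sin (m%:R * t)) dm.
rewrite /velocity /bdry /=; congr pair; rewrite derive1E.
- have -> : (fun s => expR rho0 * (cos s + d * cos (m%:R * s))) =
      expR rho0 *: (cos + d *: (cos \o *%R m%:R)) by [].
  by rewrite derive_val /GRing.scale /= mulNr mulrN mulrA mulrAC.
- have -> : (fun s => expR rho0 * (sin s - d * sin (m%:R * s))) =
      expR rho0 *: (sin - d *: (sin \o *%R m%:R)) by [].
  by rewrite derive_val /GRing.scale /= mulrA mulrAC.
Qed.

Lemma continuous_J : continuous J.
Proof.
move=> t; have cm : {for t, continuous (fun s : R => m%:R * s)}.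
  by apply: continuousM; [exact: cvg_cst|exact: cvg_id].
have csm : {for t, continuous (fun s : R => sin (m%:R * s))}.
  by apply: (continuous_comp cm); exact: continuous_sin.
have ccm : {for t, continuous (fun s : R => cos (m%:R * s))}.
  by apply: (continuous_comp cm); exact: continuous_cos.
have c1 : {for t, continuous (fun s : R =>
    expR rho0 * (- sin s - d * m%:R * sin (m%:R * s)))}.
  apply: continuousM; first exact: cvg_cst.
  apply: continuousB; first by apply: continuousN; exact: continuous_sin.
  by apply: continuousM; first exact: cvg_cst.
have c2 : {for t, continuous (fun s : R =>
    expR rho0 * (cos s - d * m%:R * cos (m%:R * s)))}.
  apply: continuousM; first exact: cvg_cst.
  apply: continuousB; first exact: continuous_cos.
  by apply: continuousM; first exact: cvg_cst.
have -> : J = fun s => Num.sqrt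
    ((expR rho0 * (- sin s - d * m%:R * sin (m%:R * s))) *
     (expR rho0 * (- sin s - d * m%:R * sin (m%:R * s))) +
     (expR rho0 * (cos s - d * m%:R * cos (m%:R * s))) *
     (expR rho0 * (cos s - d * m%:R * cos (m%:R * s)))).
  by apply/funext => s; rewrite /J /speed velocity_bdry.
apply: continuous_comp; last exact: sqrt_continuous.
by apply: continuousD; apply: continuousM.
Qed.

Lemma sigma_set0 : sigma set0 = 0%E.
Proof. by rewrite /sigma set0I integral_set0. Qed.

Lemma sigma_ge0 A : (0 <= sigma A)%E.
Proof. by apply: integral_ge0 => t _; rewrite lee_fin sqrtr_ge0. Qed.

Lemma sigma_sigma_additive : semi_sigma_additive sigma.
Proof.
have -> : sigma = fun A =>
    (\int[lebesgue_measure]_(t in A) (((EFin \o J) \_ period) t))%E.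
  by apply/funext => A; rewrite /sigma integral_mkcondr.
apply: (@semi_sigma_additive_nng_induced _ _ R lebesgue_measure); last first.
- by move=> t; rewrite patchE; case: ifP => // _; rewrite lee_fin sqrtr_ge0.
- apply/(measurable_restrictT _ _).1; first exact: measurable_itv.
  apply/measurable_funTS/measurable_EFinP.
  exact: continuous_measurable_fun continuous_J.
Qed.

HB.instance Definition _ := isMeasure.Build _ _ _
  sigma sigma_set0 sigma_ge0 sigma_sigma_additive.

Definition NP (phi : R -> R) (t : R) : R :=
  (2 * pi)^-1 * \int[sigma]_s (NP_kernel bdry t s * phi s).

Definition vc (n : nat) (t : R) : R := (J t)^-1 * cos (n%:R * t).

Definition L2norm (f : R -> R) : \bar R := ('N[sigma]_2%:E[EFin \o f])%E.

(* Closed linear span of v_1, v_2, ... in L^2(sigma). *)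
Definition Vc : set (R -> R) :=
  [set f : R -> R | f \in Lfun sigma 2%:E /\
    forall eps : R, 0 < eps -> exists (N : nat) (c : nat -> R),
      (L2norm (fun t => f t - \sum_(1 <= n < N.+1) c n * vc n t)%R
         < eps%:E)%E].

Definition NP_eigenpair (lam : R) (phi : R -> R) : Prop :=
  [/\ phi \in Vc,
      L2norm phi != 0%E &
      {ae sigma, forall t, NP phi t = lam * phi t}].

End boundary.

Arguments vc {R} rho0 m d n t.

(* The eigenvalue is alpha * d + O(d^2), the eigenfunction w d + O(d) in L^2. *)
Definition has_eigen_expansion {R : realType} (rho0 : R) (m : nat)
    (alpha : R) (w : R -> R -> R) : Prop :=
  exists (lam : R -> R) (phi : R -> R -> R) (C : R),
    \forall d \near (0 : R),
      [/\ NP_eigenpair rho0 m d (lam d) (phi d),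
          `|lam d - alpha * d| <= C * d ^+ 2 &
          (L2norm rho0 m d (fun t => phi d t - w d t)%R <= (C * `|d|)%:E)%E].

(* Main.v *)
(* Write phi = g / J with g(t) = sum_p c_p cos(p t).  In complex coordinates
   J(t) NP_kernel(t, s) is the imaginary part of z'(t) / (z(t) - z(s)), where
   z(t) = zeta + d zeta^-m, zeta = exp(i t), and
   z(t) - z(s) = (zeta - eta) (1 - d S), S = sum_(p + q = m + 1) zeta^-p eta^-q.
   Expanding in powers of d shows that the Neumann-Poincare operator acts on the
   coefficients c as d B, for an explicit infinite matrix B (the Grunsky
   coefficients of the conformal map), whose part of order 0 in d only exchanges
   e_j and e_(m+1-j), and whose remainder is O(d) from bounded to summable
   sequences.  B exchanges the residue classes of j and -j modulo m + 1, so on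
   sequences supported on the class of j the square of B is the rank one operator
   with eigenvalue j (m + 1 - j) / 4 up to O(d).  A contraction argument in the
   sup norm produces u with B (B u) = kappa u and u close to e_j; then
   u +- kappa^(-1/2) B u is an eigenvector of B for +- sqrt kappa. *)

Require Import Defs.
From HB Require Import structures.
From mathcomp Require Import all_boot all_order all_algebra.
From mathcomp Require Import all_classical all_reals all_analysis.
From mathcomp Require Import measurable_realfun.
From mathcomp Require Import ring lra zify.
From mathcomp.real_closed Require Import complex.

Set Implicit Arguments.
Unset Strict Implicit.
Unset Printing Implicit Defensive.

Import Order.TTheory GRing.Theory Num.Theory.
Import numFieldNormedType.Exports.

Local Open Scope classical_set_scope.
Local Open Scope ring_scope.

(** * Sup-norm contraction and rank-one perturbation *)

(** Squaring [B] merges the eigenvalues + and - sqrt kappa, but restricting to one residue class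
    makes the merged eigenvalue simple again: the limit there is a multiple of the projection on
    [e_j] and nothing else. Normalising [u_j = 1] then turns the eigenvalue equation into a fixed
    point equation, with no resolvent and no spectral theorem. Two norms cooperate. The contraction
    lives on bounded sequences; as [B] makes them summable, an eigenvector for a nonzero eigenvalue
    is summable for free. Its cosine series converges uniformly, can be integrated term by term, and
    l1 distances of coefficients bound sup distances of functions, hence L2 distances on the curve.
    [S] is a sum of [m] unimodular terms, so [|d S| <= m |d|]. Under [m |d| <= 1/2] all series are
    geometric, and [1 - d S] stays away from 0, so the curve has no double point. The kernel of
    order 0 in [d] is the constant 1/2 of the disc. It annihilates [g] because [c_0 = 0], which is
    why the operator carries an overall factor [d]. *)

Lemma cvg_of_tail_bound (R : realType) (u b : nat -> R) :
  (forall n k, (n <= k)%N -> `|u k - u n| <= b n) -> b @ \oo --> (0 : R) ->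
  cvgn u /\ forall n, `|limn u - u n| <= b n.
Proof.
move=> ub b0.
have uc : cvgn u.
  apply/cauchy_cvgP/cauchyP => e e0.
  have /cvgr0Pnorm_lt/(_ _ e0)[N _ /(_ N (leqnn _))]/= := b0.
  move=> /(le_lt_trans (ler_norm _)) bN; exists (u N).
  by exists N => // k /= Nk; rewrite /ball/= distrC (le_lt_trans (ub _ _ _)).
split=> // n; apply: (@cvgr_to_le _ \oo _ _ (fun k => `|u k - u n|)).
  by apply: cvg_norm; apply: cvgB; [exact: uc|exact: cvg_cst].
by exists n => // k /= nk; exact: ub.
Qed.

Lemma eq_of_tail_bound (R : realType) (x y : R) (b : nat -> R) :
  (forall n, `|x - y| <= b n) -> b @ \oo --> (0 : R) -> x = y.
Proof.
move=> xyb b0; apply/eqP; rewrite -subr_eq0 -normr_eq0.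
rewrite eq_le normr_ge0 andbT; apply: (cvgr_to_ge b0); exact: nearW.
Qed.

(** Iteration from 0 with ratio 1/2. The radius depends on the coordinate so that a support
    constraint can be imposed: [r i = 0] freezes coordinate [i]. Pointwise limits suffice because
    the rate is uniform in [i], and the contraction hypothesis itself carries [F] to the limit. *)
Lemma sup_contraction_fixpoint (R : realType) (I : Type) (r : I -> R)
    (F : (I -> R) -> I -> R) :
  (forall i, 0 <= r i) -> (forall i, r i <= 1) ->
  (forall v, (forall i, `|v i| <= r i) -> forall i, `|F v i| <= r i) ->
  (forall v w D, (forall i, `|v i| <= r i) -> (forall i, `|w i| <= r i) ->
     (forall i, `|v i - w i| <= D) -> forall i, `|F v i - F w i| <= D / 2) ->
  exists v, (forall i, `|v i| <= r i) /\ F v =1 v.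
Proof.
move=> r0 r1 Fr FL; pose u n := iter n F (fun=> 0).
have ur n i : `|u n i| <= r i.
  by elim: n i => [i|n IH i]; [rewrite normr0|apply: Fr].
have uS n i : `|u n.+1 i - u n i| <= 2^-1 ^+ n.
  elim: n i => [i|n IH i].
    by rewrite subr0 expr0; apply: le_trans (r1 i); exact: (ur 1).
  by rewrite exprSr; apply: (FL (u n.+1) (u n)) => // k; exact: ur.
(* [2 - 2 * 2^-1 ^+ k] is the sum of the first [k] terms of 1 + 1/2 + 1/4 + ... *)
have uD n k i : `|u (n + k)%N i - u n i| <= 2^-1 ^+ n * (2 - 2 * 2^-1 ^+ k).
  elim: k => [|k IH]; first by rewrite addn0 subrr normr0 expr0 mulr1 subrr mulr0.
  rewrite addnS -(subrK (u (n + k)%N i) (u (n + k).+1 i)) -addrA.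
  rewrite (le_trans (ler_normD _ _))// (le_trans (lerD (uS _ _) IH))//.
  rewrite exprD exprS; set a := 2^-1 ^+ n; set b := 2^-1 ^+ k.
  by rewrite le_eqVlt; apply/orP; left; apply/eqP; field.
have uC n k i : (n <= k)%N -> `|u k i - u n i| <= 2 * 2^-1 ^+ n.
  move=> nk; rewrite -(subnKC nk) (le_trans (uD _ _ _))// mulrC.
  by rewrite ler_wpM2r ?exprn_ge0// gerBl mulr_ge0 ?exprn_ge0.
have g0 : (2 * 2^-1 ^+ n : R) @[n --> \oo] --> (0 : R).
  rewrite -(mulr0 2); apply: cvgMr; apply: cvg_expr.
  by rewrite ger0_norm ?invr_ge0// invf_lt1// ltr1n.
pose v i := limn (fun n => u n i).
have uvc i := cvg_of_tail_bound (fun n k => @uC n k i) g0.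
have uv n i : `|v i - u n i| <= 2 * 2^-1 ^+ n by have [_] := uvc i; exact.
have vr i : `|v i| <= r i.
  apply: (@cvgr_to_le _ \oo _ _ (fun k => `|u k i|)).
    by apply: cvg_norm; have [] := uvc i.
  by apply: nearW => k; exact: ur.
exists v; split=> // i; apply: (eq_of_tail_bound _ g0) => N.
rewrite -(subrK (u N.+1 i) (F v i)) -addrA (le_trans (ler_normD _ _))//.
have := FL v (u N) _ vr (ur N) (uv N) i.
have := uv N.+1 i; rewrite distrC => h1 h2; have := lerD h2 h1.
move=> /le_trans; apply; rewrite exprS; set a := 2^-1 ^+ N.
by rewrite le_eqVlt; apply/orP; left; apply/eqP; field.
Qed.

(** Write [u = e_j + v] with [v_j = 0]. Coordinate [j] of the equation says [kap = q + (E u)_j]; the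
    others say [v_i = (E u)_i / kap], which is the fixed point equation of [F]. The set [P] is a
    support respected by [E]. *)
Lemma rank_one_perturbation_eigenvector (R : realType) (P : pred nat) (j : nat)
    (q L : R) (E : (nat -> R) -> nat -> R) :
  P j -> 0 < q -> 0 <= L -> L <= q / 8 ->
  (forall u, (forall i, `|u i| <= (P i)%:R) ->
     forall i, `|E u i| <= L * (P i)%:R) ->
  (forall u v D, (forall i, `|u i| <= (P i)%:R) ->
     (forall i, `|v i| <= (P i)%:R) -> (forall i, `|u i - v i| <= D) ->
     forall i, `|E u i - E v i| <= L * D) ->
  exists (kap : R) (u : nat -> R),
    [/\ forall i, `|u i| <= (P i)%:R, u j = 1, `|kap - q| <= L &
        forall i, q * (i == j)%:R + E u i = kap * u i].
Proof.
move=> Pj q0 L0 Lq Eb El.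
pose e (v : nat -> R) i := (i == j)%:R + v i.
pose r i : R := (P i && (i != j))%:R.
have eb v : (forall i, `|v i| <= r i) -> forall i, `|e v i| <= (P i)%:R.
  move=> vr i; rewrite /e; have := vr i; rewrite /r.
  case: (eqVneq i j) => [->|ij]; last by rewrite andbT add0r.
  by rewrite andbF Pj normr_le0 => /eqP ->; rewrite addr0 normr1.
have Ej v : (forall i, `|v i| <= r i) -> `|E (e v) j| <= L.
  by move=> /eb/Eb/(_ j); rewrite Pj mulr1.
(* From [q >= 8 * L]. The bound [7 * L] on the denominator both keeps [F] in the ball and yields the
   contraction ratio. *)
have qE v : (forall i, `|v i| <= r i) -> 7 * L <= q + E (e v) j.
  by move=> /Ej; rewrite ler_norml => /andP[? _]; lra.
have qE0 v : (forall i, `|v i| <= r i) -> 0 < q + E (e v) j.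
  by move=> /Ej; rewrite ler_norml => /andP[? _]; lra.
pose F v i := if i == j then 0 else E (e v) i / (q + E (e v) j).
have [||||v [vr Fv]] := @sup_contraction_fixpoint R nat r F.
- by move=> i; rewrite /r ler0n.
- by move=> i; rewrite /r lern1 leq_b1.
- move=> v vr i; rewrite /F; case: eqP => [_|/eqP ij]; first by rewrite normr0 ler0n.
  rewrite normrM normfV (gtr0_norm (qE0 _ vr)) ler_pdivrMr ?qE0//.
  apply: (le_trans (Eb _ (eb _ vr) i)); rewrite /r ij andbT mulrC.
  rewrite ler_wpM2l ?ler0n//; have := qE _ vr; lra.
- move=> v w D vr wr vwD i.
  have D0 : 0 <= D by apply: le_trans (normr_ge0 _) (vwD i).
  rewrite /F; case: eqP => [_|/eqP ij]; first by rewrite subrr normr0 divr_ge0.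
  have ED k : `|E (e v) k - E (e w) k| <= L * D.
    apply: El; [exact: eb|exact: eb|] => l.
    by rewrite /e opprD addrACA subrr add0r.
  have Pi1 : (P i)%:R <= 1 :> R by rewrite lern1 leq_b1.
  have Ew : `|E (e w) i| <= L.
    by apply: (le_trans (Eb _ (eb _ wr) i)); rewrite ler_piMr.
  have va := qE _ vr; have wa := qE _ wr; have va0 := qE0 _ vr; have wa0 := qE0 _ wr.
  move: (E (e w) i) (E (e v) i) Ew (ED i) (ED j) va wa va0 wa0 => y x yL.
  move: (E (e w) j) (E (e v) j) => b a xy ab va wa va0 wa0.
  (* The changes of numerator and of denominator are separated; each costs at most [D / 7], and 2/7
     is below 1/2. *)
  have -> : x / (q + a) - y / (q + b) =
      (x - y) / (q + a) - y / (q + b) * ((a - b) / (q + a)).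
    by field; rewrite !gt_eqF.
  have h z : `|z| <= L * D -> `|z / (q + a)| <= D / 7.
    move=> zLD; rewrite normrM normfV (gtr0_norm va0) ler_pdivrMr//.
    apply: (le_trans zLD); rewrite mulrAC -mulrA.
    by rewrite [L * D]mulrC ler_wpM2l// ler_pdivlMr// mulrC.
  have yb : `|y / (q + b)| <= 1.
    rewrite normrM normfV (gtr0_norm wa0) ler_pdivrMr// mul1r.
    by apply: (le_trans yL); lra.
  rewrite (le_trans (ler_normB _ _))// (le_trans (lerD (h _ xy) (lexx _)))// normrM.
  rewrite (le_trans (lerD (lexx _) (ler_pM (normr_ge0 _) (normr_ge0 _) yb (h _ ab))))//.
  lra.
have vj : v j = 0 by rewrite -Fv /F eqxx.
exists (q + E (e v) j), (e v); split.
- exact: eb.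
- by rewrite /e eqxx vj addr0.
- by rewrite addrC addKr Ej.
- move=> i; rewrite {3}/e; case: (eqVneq i j) => [->|ij].
    by rewrite vj addr0 !mulr1.
  rewrite mulr0 !add0r -(Fv i) /F (negbTE ij) mulrC divfK// gt_eqF// qE0//.
Qed.

(** * The operator on cosine coefficients *)

(* With x = eta / zeta, the S of the header is eta^-(m+1) * (sigpoly m).[x], so
   the coefficient of zeta^-p eta^-(n(m+1)-p) in S^n is that of X^p in
   sigpoly^n. *)
Definition sigpoly (A : nzRingType) (m : nat) : {poly A} :=
  \sum_(i < m) 'X^(i.+1).

Section grunsky.
Context {R : realType} (m : nat).
Implicit Types (d C : R) (c u v : nat -> R).

(** In [log (1 - d S) = - sum_n d^(n+1) S^(n+1) / (n+1)], differentiation in [t] brings down [p].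
    The last 1/2 is [pi], the integral of a squared cosine over a period, against the prefactor
    [1 / (2 * pi)] of the operator. *)
Definition grunsky (n p : nat) : R :=
  p%:R / n.+1%:R * (sigpoly R m ^+ n.+1)`_p / 2.

Lemma sigpoly_exp_coef_ge0 n p : 0 <= (sigpoly R m ^+ n)`_p.
Proof.
elim: n p => [|n IH] p; first by rewrite expr0 coef1 ler0n.
rewrite exprS coefM sumr_ge0// => i _; rewrite mulr_ge0//.
by rewrite /sigpoly coef_sum sumr_ge0// => k _; rewrite coefXn ler0n.
Qed.

Lemma size_sigpoly_exp (A : nzRingType) n :
  (size (sigpoly A m ^+ n) <= (n * m).+1)%N.
Proof.
apply: (leq_trans (size_poly_exp_leq _ _)); rewrite ltnS mulnC leq_mul2l.
apply/orP; right; rewrite -subn1 leq_subLR add1n.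
apply: (leq_trans (size_sum _ _ _)); apply/bigmax_leqP => i _.
by rewrite size_polyXn ltnS.
Qed.

Lemma sum_sigpoly_exp_coef n P : \sum_(p < P) (sigpoly R m ^+ n)`_p <= m%:R ^+ n.
Proof.
set s := sigpoly R m ^+ n; have sP : (size s <= P + size s)%N by rewrite leq_addl.
have -> : m%:R ^+ n = s.[1].
  rewrite /s horner_exp /sigpoly horner_sum; congr (_ ^+ _).
  under eq_bigr do rewrite hornerXn expr1n.
  by rewrite sumr_const card_ord.
rewrite (horner_coef_wide _ sP) big_split_ord/=.
under [in leRHS]eq_bigr do rewrite expr1n mulr1.
by rewrite lerDl sumr_ge0// => i _; rewrite expr1n mulr1 sigpoly_exp_coef_ge0.
Qed.

Lemma grunsky_ge0 n p : 0 <= grunsky n p.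
Proof. by rewrite /grunsky !mulr_ge0// ?sigpoly_exp_coef_ge0 ?invr_ge0. Qed.

Lemma grunsky_eq0 n p : (n.+1 * m < p)%N -> grunsky n p = 0.
Proof.
move=> h; rewrite /grunsky nth_default ?mulr0 ?mul0r//.
exact: leq_trans (size_sigpoly_exp _ _) h.
Qed.

(** Where the coefficient does not vanish, [p <= (n + 1) m], so [p / (n + 1) <= m]. *)
Lemma grunsky_le n p : grunsky n p <= m%:R * (sigpoly R m ^+ n.+1)`_p.
Proof.
have [np|pn] := ltnP (n.+1 * m) p.
  by rewrite grunsky_eq0// mulr_ge0// sigpoly_exp_coef_ge0.
rewrite /grunsky ler_pdivrMr// -[leRHS]mulrA ler_pM ?divr_ge0 ?sigpoly_exp_coef_ge0//.
  by rewrite ler_pdivrMr// -natrM ler_nat mulnC.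
by rewrite ler_peMr ?sigpoly_exp_coef_ge0// ler1n.
Qed.

Lemma sum_grunsky n P : \sum_(p < P) grunsky n p <= m%:R ^+ n.+2.
Proof.
apply: le_trans (ler_sum _ (fun (i : 'I_P) _ => grunsky_le n i)) _.
rewrite -mulr_sumr [leRHS]exprS.
by rewrite ler_wpM2l// sum_sigpoly_exp_coef.
Qed.

(* npm is the matrix B of the header.  The truncated subtraction is harmless:
   grunsky n p = 0 as soon as p > (n + 1) m. *)
Definition npm_part d (M : nat) c (p : nat) : R :=
  \sum_(n < M) d ^+ n * grunsky n p * c (n.+1 * m.+1 - p)%N.

Definition npm d c (p : nat) : R := limn (fun M => npm_part d M c p).

Lemma npm_partB d M N c p : (M <= N)%N ->
  npm_part d N c p - npm_part d M c p =
  \sum_(M <= n < N) d ^+ n * grunsky n p * c (n.+1 * m.+1 - p)%N.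
Proof.
move=> MN; rewrite /npm_part.
rewrite -!(big_mkord xpredT (fun n => d ^+ n * grunsky n p * c (n.+1 * m.+1 - p)%N)).
by rewrite (big_cat_nat (leq0n M) MN)/= addrAC subrr add0r.
Qed.

Lemma geometric_tail (x : R) M N : 0 <= x -> x <= 2^-1 -> (M <= N)%N ->
  \sum_(M <= n < N) x ^+ n <= 2 * x ^+ M.
Proof.
move=> x0 x1 MN; apply: (@le_trans _ _ (2 * x ^+ M - 2 * x ^+ N)); last first.
  by rewrite gerBl mulr_ge0// exprn_ge0.
rewrite -(subnKC MN); elim: (N - M)%N => [|k IH]; first by rewrite addn0 big_geq// subrr.
rewrite addnS big_nat_recr ?leq_addr//= (le_trans (lerD IH (lexx _)))//.
have := exprn_ge0 (M + k) x0; rewrite exprS; set a := x ^+ (M + k) => a0.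
have : x * a <= 2^-1 * a by rewrite ler_wpM2r.
lra.
Qed.

Section bounded.
Variables (d C : R) (c : nat -> R).
Hypotheses (hd : m%:R * `|d| <= 2^-1) (hc : forall p, `|c p| <= C).

Let C0 : 0 <= C. Proof. exact: le_trans (hc 0). Qed.

(** For fixed [n], each [p] reads a single entry of [c], so summing over [p] only costs the sum of
    [grunsky n p]: bounded sequences become summable. Later [M = 0] bounds the whole operator,
    [M = 1] isolates its leading part, and general [M] gives convergence. *)
Lemma npm_part_tail M N P : (M <= N)%N ->
  \sum_(p < P) `|npm_part d N c p - npm_part d M c p| <=
    2 * m%:R ^+ 2 * C * (m%:R * `|d|) ^+ M.
Proof.
move=> MN; under eq_bigr do rewrite npm_partB//.
apply: (@le_trans _ _ (\sum_(p < P) \sum_(M <= n < N) `|d| ^+ n * grunsky n p * C)).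
  apply: ler_sum => p _; apply: (le_trans (ler_norm_sum _ _ _)).
  apply: ler_sum => n _; rewrite normrM normrM normrX (ger0_norm (grunsky_ge0 _ _)).
  by rewrite ler_wpM2l// mulr_ge0 ?exprn_ge0 ?grunsky_ge0.
rewrite exchange_big/=.
apply: (@le_trans _ _ (\sum_(M <= n < N) m%:R ^+ 2 * C * (m%:R * `|d|) ^+ n)).
  apply: ler_sum => n _; rewrite -mulr_suml -mulr_sumr exprMn.
  have := sum_grunsky n P; set a := \sum_(p < P) _ => aP.
  have -> : m%:R ^+ 2 * C * (m%:R ^+ n * `|d| ^+ n) = `|d| ^+ n * m%:R ^+ n.+2 * C :> R.
    by rewrite !exprS; ring.
  by rewrite ler_wpM2r// ler_wpM2l// exprn_ge0.
rewrite -mulr_sumr.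
have -> : 2 * m%:R ^+ 2 * C * (m%:R * `|d|) ^+ M =
  m%:R ^+ 2 * C * (2 * (m%:R * `|d|) ^+ M) by ring.
by rewrite ler_wpM2l ?geometric_tail// mulr_ge0// exprn_ge0.
Qed.

Lemma npm_tail_cvg : 2 * m%:R ^+ 2 * C * (m%:R * `|d|) ^+ M @[M --> \oo] --> (0 : R).
Proof.
rewrite -(mulr0 (2 * m%:R ^+ 2 * C)); apply: cvgMr; apply: cvg_expr.
by rewrite ger0_norm ?mulr_ge0// (le_lt_trans hd)// invf_lt1// ltr1n.
Qed.

Lemma npm_part_cvg p : npm_part d M c p @[M --> \oo] --> npm d c p.
Proof.
apply: (proj1 (cvg_of_tail_bound _ npm_tail_cvg)) => n k nk.
apply: le_trans (npm_part_tail p.+1 nk).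
by rewrite big_ord_recr/= lerDr sumr_ge0.
Qed.

Lemma npm_tail M P :
  \sum_(p < P) `|npm d c p - npm_part d M c p| <=
    2 * m%:R ^+ 2 * C * (m%:R * `|d|) ^+ M.
Proof.
apply: (@cvgr_to_le _ \oo _ _
    (fun N => \sum_(p < P) `|npm_part d N c p - npm_part d M c p|)).
  apply: cvg_big => [|p _]; first exact: add_continuous.
  by apply: cvg_norm; apply: cvgB; [exact: npm_part_cvg|exact: cvg_cst].
by exists M => // N /= MN; exact: npm_part_tail.
Qed.

Lemma npm_support p :
  (forall n, (p <= n.+1 * m)%N -> c (n.+1 * m.+1 - p)%N = 0) -> npm d c p = 0.
Proof.
move=> h; apply/(cvg_lim (@Rhausdorff R)); have -> : (fun M => npm_part d M c p) = cst 0.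
  apply/funext => M; rewrite /npm_part big1// => n _.
  have [np|pn] := ltnP (n.+1 * m) p; first by rewrite grunsky_eq0// mulr0 mul0r.
  by rewrite h// mulr0.
exact: cvg_cst.
Qed.

End bounded.

Lemma npm_linear d C a b u v : m%:R * `|d| <= 2^-1 ->
  (forall p, `|u p| <= C) -> (forall p, `|v p| <= C) ->
  npm d (fun p => a * u p + b * v p) =1 (fun p => a * npm d u p + b * npm d v p).
Proof.
move=> hd hu hv p; apply/(cvg_lim (@Rhausdorff R)).
have -> : (fun M => npm_part d M (fun p => a * u p + b * v p) p) =
    (fun M => a * npm_part d M u p + b * npm_part d M v p).
  apply/funext => M; rewrite /npm_part !mulr_sumr -big_split/=.
  by apply: eq_bigr => n _; ring.
by apply: cvgD; apply: cvgMr; exact: npm_part_cvg.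
Qed.

End grunsky.

(** * Eigenvectors of the coefficient matrix for small [d] *)

Section npm_spectrum.
Context {R : realType} (m : nat).
Implicit Types (d C : R) (u : nat -> R) (j k p P : nat).

Local Notation K := (2 * m%:R ^+ 2 : R).
Local Notation npm := (@npm R m).

(** Entry [p] of the image reads [u] at [(n + 1) (m + 1) - p], which is congruent to [- p]. *)
Lemma npm_class d u j k :
  (j + k = m.+1)%N -> (forall p, u p != 0 -> p = j %[mod m.+1]) ->
  forall p, npm d u p != 0 -> p = k %[mod m.+1].
Proof.
move=> jk uj p; apply: contra_neqP => pk.
apply: npm_support => n pn; apply/eqP/negP => /negP/uj idx; apply: pk.
have pN : (p <= n.+1 * m.+1)%N by rewrite (leq_trans pn)// leq_mul2l leqnSn orbT.
apply/eqP; rewrite -(eqn_modDr j) addnC; apply/eqP.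
rewrite [in RHS]addnC jk modnn -modnDml -idx modnDml.
by rewrite subnK// modnMl.
Qed.

Lemma npm_part0 d u p : npm_part m d 0 u p = 0.
Proof. by rewrite /npm_part big_ord0. Qed.

Lemma npm_part1 d u p :
  npm_part m d 1 u p = (0 < p <= m)%N%:R * (p%:R / 2 * u (m.+1 - p)%N).
Proof.
rewrite /npm_part big_ord1 expr0 mul1r mul1n /grunsky divr1 expr1 /sigpoly coef_sum.
have [/andP[p0 pm]|pm] := boolP (0 < p <= m)%N.
  have p1m : (p.-1 < m)%N by rewrite prednK.
  rewrite (bigD1 (Ordinal p1m))//= coefXn prednK// eqxx big1 ?addr0 ?mulr1 ?mul1r//.
  move=> i ip; rewrite coefXn; case: eqP => // pi; case/eqP: ip.
  by apply/val_inj; rewrite /= pi.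
rewrite big1 ?mulr0 ?mul0r// => i _; rewrite coefXn; case: eqP => // pi.
by move: pm; rewrite pi/= ltn_ord.
Qed.

(** The order 0 part at [p], [1 <= p <= m], reads [u] at [m + 1 - p], which lies in the class of [j]
    only for [p = k]. All the rest is the tail from [M = 1] on. *)
Lemma npm_lead d C u j k P : m%:R * `|d| <= 2^-1 -> (forall p, `|u p| <= C) ->
  (0 < j)%N -> (0 < k)%N -> (j + k = m.+1)%N ->
  (forall p, u p != 0 -> p = j %[mod m.+1]) ->
  \sum_(p < P) `|npm d u p - k%:R / 2 * u j * (nat_of_ord p == k)%:R| <=
    K * C * (m%:R * `|d|).
Proof.
move=> hd hu j0 k0 jk uj; have := npm_tail hd hu 1 P; rewrite expr1.
apply: le_trans; apply: ler_sum => p _; rewrite npm_part1.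
have kE : (m.+1 - k = j)%N by rewrite -jk addnK.
have km : (k <= m)%N by rewrite -ltnS -jk -[X in (X < _)%N]add0n ltn_add2r.
case: (eqVneq (nat_of_ord p) k) => [->|pk].
  by rewrite k0 km/= mul1r mulr1 kE.
rewrite mulr0 (_ : _ * _ = 0)//; apply/eqP; rewrite mulf_eq0.
case: (boolP (0 < p <= m)%N) => [/andP[p0 pm]|]; last by rewrite eqxx.
apply/orP; right; rewrite mulf_eq0; apply/orP; right; apply/negP => /negP/uj.
have jm : (j <= m)%N by rewrite -ltnS -jk -[X in (X < _)%N]addn0 ltn_add2l.
rewrite (@modn_small j)// modn_small ?ltn_subrL ?p0// => jp.
by case/eqP: pk; apply: (@addnI j); rewrite jk -jp subnK// leqW.
Qed.

(** [B u] is [(k / 2) u_j e_k] plus a small [D]; [B] is applied to both. In [K * (m + K)], [m]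
    bounds the scalar in front of [e_k] (up to [C]), and the second [K] bounds [B] on [D]. *)
Lemma npm2_lead d C u j k P : m%:R * `|d| <= 2^-1 -> (forall p, `|u p| <= C) ->
  (0 < j)%N -> (0 < k)%N -> (j + k = m.+1)%N ->
  (forall p, u p != 0 -> p = j %[mod m.+1]) ->
  \sum_(p < P) `|npm d (npm d u) p - j%:R * k%:R / 4 * u j * (nat_of_ord p == j)%:R| <=
    K * (m%:R + K) * C * (m%:R * `|d|).
Proof.
move=> hd hu j0 k0 jk uj; set x := m%:R * `|d|.
have x0 : 0 <= x by rewrite mulr_ge0.
have C0 : 0 <= C by exact: le_trans (hu 0).
have K0 : 0 <= K by rewrite mulr_ge0// exprn_ge0.
have kj : (k + j = m.+1)%N by rewrite addnC.
pose e p : R := (p == k)%:R.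
pose D p := npm d u p - k%:R / 2 * u j * e p.
have Dsum Q : \sum_(p < Q) `|D p| <= K * C * x by apply: npm_lead.
have Db p : `|D p| <= K * C * x.
  by apply: le_trans (Dsum p.+1); rewrite big_ord_recr/= lerDr sumr_ge0.
have eb p : `|e p| <= 1 by rewrite /e normr_nat lern1 leq_b1.
have ej p : e p != 0 -> p = k %[mod m.+1].
  by rewrite /e pnatr_eq0 eqb0 negbK => /eqP ->.
have -> : npm d u = fun p => k%:R / 2 * u j * e p + 1 * D p.
  by apply/funext => p; rewrite mul1r addrC subrK.
have b1 p : `|e p| <= 1 + K * C * x by apply: (le_trans (eb p)); rewrite lerDl !mulr_ge0.
have b2 p : `|D p| <= 1 + K * C * x by apply: (le_trans (Db p)); rewrite lerDr.
apply: (@le_trans _ _ (\sum_(p < P)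
  (m%:R * C * `|npm d e p - j%:R / 2 * (nat_of_ord p == j)%:R| + `|npm d D p|))).
  apply: ler_sum => p _; rewrite (npm_linear _ _ hd b1 b2) mul1r.
  have -> : k%:R / 2 * u j * npm d e p + npm d D p -
      j%:R * k%:R / 4 * u j * (nat_of_ord p == j)%:R =
      k%:R / 2 * u j * (npm d e p - j%:R / 2 * (nat_of_ord p == j)%:R) + npm d D p.
    by field.
  rewrite (le_trans (ler_normD _ _))// lerD2r normrM ler_wpM2r// normrM.
  rewrite ler_pM// ger0_norm ?divr_ge0// ler_pdivrMr// -natrM ler_nat.
  by rewrite -[k]muln1 leq_mul// -ltnS -jk -[X in (X < _)%N]add0n ltn_add2r.
rewrite big_split/= -mulr_sumr.
have h1 := npm_lead P hd eb k0 j0 kj ej.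
have h2 := npm_tail hd Db 0 P.
have -> : K * (m%:R + K) * C * x = m%:R * C * (K * 1 * x) + K * (K * C * x) * x ^+ 0.
  by rewrite expr0; ring.
apply: lerD; first apply: ler_wpM2l; first by rewrite mulr_ge0.
  by move: h1; under eq_bigr do rewrite {2}/e eqxx mulr1.
apply: le_trans h2; apply: ler_sum => p _.
by rewrite npm_part0 subr0.
Qed.

(** The perturbation [E] is [B^2] minus its leading part. It is linear on bounded sequences, so its
    size estimate is also its Lipschitz estimate, and it preserves the class of [j] because [B]
    sends [j] to [k] and [k] back to [j]. *)
Lemma npm_square_eigenvector d j k :
  (0 < j)%N -> (0 < k)%N -> (j + k = m.+1)%N ->
  m%:R * `|d| <= 2^-1 ->
  K * (m%:R + K) * (m%:R * `|d|) <= j%:R * k%:R / 4 / 8 ->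
  exists (kap : R) (u : nat -> R),
    [/\ forall p, `|u p| <= 1,
        forall p, u p != 0 -> p = j %[mod m.+1],
        u j = 1,
        `|kap - j%:R * k%:R / 4| <= K * (m%:R + K) * (m%:R * `|d|) &
        forall p, npm d (npm d u) p = kap * u p].
Proof.
move=> j0 k0 jk hd; set q := _ / 4; set L := K * _ * _ => Lq.
have q0 : 0 < q by rewrite divr_gt0// mulr_gt0// ltr0n.
have L0 : 0 <= L by rewrite !mulr_ge0// addr_ge0// mulr_ge0// exprn_ge0.
pose Pr := [pred p | p == j %[mod m.+1]].
pose E u p := npm d (npm d u) p - q * u j * (p == j)%:R.
have Prb u : (forall i, `|u i| <= (Pr i)%:R) -> forall i, `|u i| <= 1.
  by move=> h i; apply: (le_trans (h i)); rewrite lern1 leq_b1.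
have Prs u : (forall i, `|u i| <= (Pr i)%:R) -> forall p, u p != 0 -> p = j %[mod m.+1].
  move=> h p; apply: contra_neqP => /eqP/negbTE pj; apply/eqP.
  by rewrite -normr_le0; have := h p; rewrite /= pj.
have Es C u : (forall i, `|u i| <= C) -> (forall p, u p != 0 -> p = j %[mod m.+1]) ->
    forall i, `|E u i| <= L * C.
  move=> uC us i; have := npm2_lead i.+1 hd uC j0 k0 jk us.
  rewrite -/q [L * C]mulrAC; apply: le_trans.
  by rewrite big_ord_recr/= lerDr sumr_ge0.
have npmb C u : (forall i, `|u i| <= C) -> forall i, `|npm d u i| <= K * C.
  move=> uC i; have := npm_tail hd uC 0 i.+1; rewrite expr0 mulr1; apply: le_trans.
  by rewrite big_ord_recr/= npm_part0 subr0 lerDr sumr_ge0.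
have [||||||kap [u [ub uj kq uE]]] := @rank_one_perturbation_eigenvector R Pr j q L E.
- by rewrite /=.
- exact: q0.
- exact: L0.
- exact: Lq.
- move=> u uP i; case: (boolP (Pr i)) => [_|Pi].
    by rewrite mulr1 -[L]mulr1; apply: Es; [exact: Prb|exact: Prs].
  rewrite mulr0 normr_le0 /E; have -> : (i == j) = false.
    by apply/negbTE; apply: contra Pi => /eqP ->/=.
  rewrite mulr0 subr0; apply: contraNT Pi => /= Bi; apply/eqP.
  apply: (npm_class _ (npm_class jk (Prs _ uP)) Bi).
  by rewrite addnC.
- move=> u v D uP vP uvD i.
  have -> : E u i - E v i = E (fun p => u p - v p) i.
    rewrite /E; have -> : (fun p => u p - v p) = (fun p => 1 * u p + (-1) * v p).
      by apply/funext => p; rewrite mul1r mulN1r.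
    have -> : npm d (fun p => 1 * u p + (-1) * v p) =
        (fun p => 1 * npm d u p + (-1) * npm d v p).
      by apply/funext => p; apply: (npm_linear 1 (-1) hd (Prb _ uP) (Prb _ vP)).
    rewrite (npm_linear 1 (-1) hd (npmb _ _ (Prb _ uP)) (npmb _ _ (Prb _ vP))).
    by ring.
  apply: Es => // p; apply: contra_neqP => /eqP/negbTE pj.
  have := uP p; have := vP p; rewrite /= pj !normr_le0 => /eqP -> /eqP ->.
  by rewrite subrr.
exists kap, u; split=> //; [exact: Prb|exact: Prs|move=> p].
by rewrite -uE /E uj mulr1 addrC subrK.
Qed.

End npm_spectrum.

Lemma near0_mulr_norm_le (R : realType) (a e : R) : 0 <= a -> 0 < e ->
  \forall d \near (0 : R), a * `|d| <= e.
Proof.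
move=> a0 e0; have e'0 : 0 < e / (a + 1) by rewrite divr_gt0// ltr_wpDl.
near=> d; have : `|d| < e / (a + 1) by near: d; exact: (@nbhs0_lt R R^o _ e'0).
rewrite ltr_pdivlMr ?ltr_wpDl// mulrDr mulr1 mulrC => h.
by rewrite (le_trans _ (ltW h))// lerDl.
Unshelve. all: by end_near. Qed.

(** The normalisation by [sqrt j] is the right one: [B u] is close to [(k / 2) e_k] and [sqrt kap]
    to [sqrt (j k) / 2], so [(sqrt j / sqrt kap) B u] is close to [sqrt k e_k]. For [j = k] and the
    minus sign the limit vector is 0, so no claim [c != 0] is made here. *)
Lemma npm_eigenvector (R : realType) (m j k : nat) (b : bool) :
  (0 < j)%N -> (0 < k)%N -> (j + k = m.+1)%N ->
  exists Cst : R, \forall d \near (0 : R), exists (mu : R) (c : nat -> R) (B : R),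
    [/\ forall p, `|c p| <= B, mu != 0, forall p, npm m d c p = mu * c p,
        `|mu - (-1) ^+ b * (Num.sqrt (j%:R * k%:R) / 2)| <= Cst * `|d| &
        forall P, \sum_(p < P) `|c p - (Num.sqrt j%:R * (nat_of_ord p == j)%:R +
            (-1) ^+ b * (Num.sqrt k%:R * (nat_of_ord p == k)%:R))| <= Cst * `|d|].
Proof.
move=> j0 k0 jk; pose K : R := 2 * m%:R ^+ 2; pose L0 := K * (m%:R + K).
have K0 : 0 <= K by rewrite mulr_ge0// exprn_ge0.
have L00 : 0 <= L0 by rewrite mulr_ge0// addr_ge0.
have jR : 1 <= j%:R :> R by rewrite ler1n.
have kR : 1 <= k%:R :> R by rewrite ler1n.
pose q : R := j%:R * k%:R / 4; pose r0 := Num.sqrt q.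
have q4 : 4^-1 <= q.
  by rewrite /q ler_pdivlMr// mulVf// -[leLHS]mulr1 ler_pM.
pose sj : R := Num.sqrt j%:R; pose sk : R := Num.sqrt k%:R.
have sj1 : 1 <= sj by rewrite -[1]sqrtr1 ler_wsqrtr.
have sk1 : 1 <= sk by rewrite -[1]sqrtr1 ler_wsqrtr.
have sj2 : sj * sj = j%:R by rewrite -expr2 sqr_sqrtr// (le_trans ler01).
have sk2 : sk * sk = k%:R by rewrite -expr2 sqr_sqrtr// (le_trans ler01).
have sjk : Num.sqrt (j%:R * k%:R) = sj * sk by rewrite sqrtrM// (le_trans ler01).
have r0E : r0 = sj * sk / 2.
  have -> : r0 = Num.sqrt ((sj * sk / 2) ^+ 2).
    by rewrite /r0 /q -sj2 -sk2; congr Num.sqrt; field.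
  by rewrite sqrtr_sqr ger0_norm// divr_ge0// mulr_ge0// (le_trans ler01).
have r02 : 2^-1 <= r0.
  by rewrite r0E ler_pdivlMr// mulVf// -[leLHS]mulr1 ler_pM.
have jm : (j <= m)%N by rewrite -ltnS -jk -[X in (X < _)%N]addn0 ltn_add2l.
have km : (k <= m)%N by rewrite -ltnS -jk -[X in (X < _)%N]add0n ltn_add2r.
have sjm : sj <= m%:R.
  by apply: (@le_trans _ _ (sj * sj)); [rewrite ler_peMr// (le_trans ler01)|rewrite sj2 ler_nat].
have skm : sk <= m%:R.
  by apply: (@le_trans _ _ (sk * sk)); [rewrite ler_peMr// (le_trans ler01)|rewrite sk2 ler_nat].
have m0 : 0 <= m%:R :> R by [].
have sumd P i : \sum_(p < P) (nat_of_ord p == i)%:R <= 1 :> R.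
  case: (ltnP i P) => [iP|Pi].
    rewrite (bigD1 (Ordinal iP))//= eqxx big1 ?addr0// => p pi.
    by rewrite (_ : _ == _ = false)//; apply: contraNF pi => /eqP pi; apply/eqP/val_inj.
  rewrite big1// => p _; rewrite (_ : _ == _ = false)//.
  by apply/negbTE; rewrite neq_ltn (leq_trans (ltn_ord p)).
(* [2 * L0] serves the eigenvalue; [24 * m * L0 = (16 + 8) * m * L0] and [4 * m * K] serve the
   coefficients. The outer [m] comes from [x = m * |d|]. *)
exists ((24 * m%:R * L0 + 4 * m%:R * K + 2 * L0) * m%:R).
near=> d; set x := m%:R * `|d|; set L := L0 * x.
have x0 : 0 <= x by rewrite mulr_ge0.
have L_ge0 : 0 <= L by rewrite mulr_ge0.
have hd : m%:R * `|d| <= 2^-1 by near: d; apply: near0_mulr_norm_le.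
(* 1/32 is one eighth of the lower bound 1/4 for [q], as the contraction requires; it also leaves
   [kap] above 1/5. *)
have hL : L <= 32^-1.
  rewrite /L /x mulrA; near: d; apply: near0_mulr_norm_le => //.
  by rewrite mulr_ge0.
have [|kap [u [u1 us uj kq Bu]]] := @npm_square_eigenvector R m d j k j0 k0 jk hd.
  by rewrite -/K -/L0 -/x -/L -/q; move: hL q4; clear; move: L q => L q *; lra.
rewrite -/K -/L0 -/x -/L -/q in kq.
have kap0 : 5^-1 <= kap by move: kq hL q4; clear; rewrite ler_norml => /andP[+ _]; move: L q => L q *; lra.
have kap_gt0 : 0 < kap by apply: lt_le_trans kap0.
pose r := Num.sqrt kap.
have rr : r * r = kap by rewrite -expr2 sqr_sqrtr// ltW.
have r_gt0 : 0 < r by rewrite sqrtr_gt0.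
have r4 : 4^-1 <= r by rewrite leNgt; apply/negP => h; move: kap0 h r_gt0; rewrite -rr; clear; move: r => r *; nra.
have rr0 : `|r - r0| <= 2 * L.
  have : `|r - r0| * (r + r0) <= L.
    rewrite -(ger0_norm (_ : 0 <= r + r0)) ?addr_ge0 ?sqrtr_ge0// -normrM -subr_sqr.
    by rewrite expr2 rr sqr_sqrtr// (le_trans _ q4).
  have : 2^-1 <= r + r0 by rewrite (le_trans r02)// lerDr ltW.
  move=> /(ler_wpM2l (normr_ge0 (r - r0))); clear.
  by move: `|r - r0| (r + r0) L => *; lra.
pose s : R := (-1) ^+ b.
have s1 : `|s| = 1 by rewrite /s normrX normrN1 expr1n.
have ss : s * s = 1 by rewrite -expr2 sqrr_sign.
have Bu1 p : `|npm m d u p| <= K.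
  have := npm_tail hd u1 0 p.+1; rewrite expr0 mulr1 mulr1; apply: le_trans.
  by rewrite big_ord_recr/= npm_part0 subr0 lerDr sumr_ge0.
(* Sup-norm closeness is upgraded to l1 closeness through [u = kap^-1 B^2 u], since [B^2 u] is
   l1-close to [q e_j]. *)
have S1 P : \sum_(p < P) `|u p - (nat_of_ord p == j)%:R| <= 16 * L.
  have := npm2_lead P hd u1 j0 k0 jk us; rewrite uj !mulr1 -/K -/L0 -/x -/L -/q => h.
  have : \sum_(p < P) `|u p - (nat_of_ord p == j)%:R| <= 5 * (L + L * 1).
    apply: le_trans (_ : \sum_(p < P) 5 * (`|npm m d (npm m d u) p - q * (nat_of_ord p == j)%:R|
      + L * (nat_of_ord p == j)%:R) <= _); last first.
      by rewrite -mulr_sumr big_split/= -mulr_sumr ler_wpM2l// lerD// ler_wpM2l ?sumd.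
    have kV : kap^-1 <= 5 by rewrite -[leRHS]invrK lef_pV2 ?posrE ?invr_gt0.
    apply: ler_sum => p _.
    have -> : u p - (nat_of_ord p == j)%:R = kap^-1 * (npm m d (npm m d u) p
        - q * (nat_of_ord p == j)%:R - (kap - q) * (nat_of_ord p == j)%:R).
      by rewrite Bu; field; rewrite gt_eqF.
    rewrite normrM ler_pM//.
      by rewrite ger0_norm ?invr_ge0 ?(ltW kap_gt0).
    rewrite (le_trans (ler_normB _ _))// lerD2l normrM normr_nat ler_wpM2r//.
  move=> /le_trans; apply; have -> : 5 * (L + L * 1) = 10 * L by ring.
  by rewrite ler_wpM2r// ler_nat.
have S2 P : \sum_(p < P) `|npm m d u p - k%:R / 2 * (nat_of_ord p == k)%:R| <= K * x.
  by have := npm_lead P hd u1 j0 k0 jk us; rewrite uj !mulr1.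
exists (s * r), (fun p => sj * u p + s * sj / r * npm m d u p), (sj * 1 + `|s * sj / r| * K).
split.
- move=> p; rewrite (le_trans (ler_normD _ _))// !normrM lerD//.
    by rewrite (ger0_norm (le_trans ler01 sj1)) ler_wpM2l ?u1// (le_trans ler01).
  by rewrite -!normrM normrM ler_wpM2l ?Bu1.
- by rewrite mulf_neq0//; [rewrite -normr_gt0 s1|rewrite gt_eqF].
- have Bu2 p : `|npm m d u p| <= 1 + K by rewrite (le_trans (Bu1 p))// lerDr.
  have u2 p : `|u p| <= 1 + K by rewrite (le_trans (u1 p))// lerDl.
  move=> p; rewrite (npm_linear _ _ hd u2 Bu2) Bu -rr.
  rewrite mulrDr; have -> : s * r * (s * sj / r * npm m d u p) = (s * s) * sj * npm m d u p.
    by field; rewrite gt_eqF.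
  by rewrite ss mul1r addrC; congr (_ + _); field; rewrite gt_eqF.
- rewrite -/s sjk -r0E -mulrBr normrM s1 mul1r (le_trans rr0)// /L /x.
  rewrite !mulrA ler_wpM2r// ler_wpM2r// lerDr addr_ge0// !mulr_ge0// addr_ge0//.
- move=> P; rewrite -/s.
  apply: le_trans (_ : \sum_(p < P) (m%:R * `|u p - (nat_of_ord p == j)%:R| +
     4 * m%:R * `|npm m d u p - k%:R / 2 * (nat_of_ord p == k)%:R| +
     8 * m%:R * L * (nat_of_ord p == k)%:R) <= _).
    apply: ler_sum => p _.
    (* Three errors: [u] against [e_j], [B u] against [(k / 2) e_k], and [r] against [r0]. *)
    have -> : sj * u p + s * sj / r * npm m d u p - (sj * (nat_of_ord p == j)%:R +
        s * (sk * (nat_of_ord p == k)%:R)) = sj * (u p - (nat_of_ord p == j)%:R) +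
        s * sj / r * (npm m d u p - k%:R / 2 * (nat_of_ord p == k)%:R) +
        s * sk / r * (r0 - r) * (nat_of_ord p == k)%:R.
      by rewrite r0E -sk2; field; rewrite gt_eqF.
    have rV : r^-1 <= 4 by rewrite -[leRHS]invrK lef_pV2 ?posrE ?invr_gt0.
    rewrite (le_trans (ler_normD _ _))// lerD//; last first.
      rewrite normrM normr_nat ler_wpM2r// !normrM s1 mul1r distrC.
      rewrite (ger0_norm (le_trans ler01 sk1)) ger0_norm ?invr_ge0 ?(ltW r_gt0)//.
      have -> : 8 * m%:R * L = m%:R * 4 * (2 * L) by ring.
      by rewrite ler_pM// ?mulr_ge0 ?invr_ge0 ?(ltW r_gt0) ?(le_trans ler01)// ler_pM// ?invr_ge0 ?(ltW r_gt0) ?(le_trans ler01).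
    rewrite (le_trans (ler_normD _ _))// lerD//.
      by rewrite normrM ler_wpM2r// ger0_norm// (le_trans ler01).
    rewrite normrM ler_wpM2r// !normrM s1 mul1r mulrC.
    rewrite (ger0_norm (le_trans ler01 sj1)) ger0_norm ?invr_ge0 ?(ltW r_gt0)//.
    by rewrite ler_pM// ?invr_ge0 ?(ltW r_gt0) ?(le_trans ler01).
  rewrite !big_split/= -!mulr_sumr.
  apply: le_trans (_ : m%:R * (16 * L) + 4 * m%:R * (K * x) + 8 * m%:R * L * 1 <= _).
    apply: lerD; [apply: lerD|]; apply: ler_wpM2l; rewrite ?mulr_ge0 ?addr_ge0//;
      [exact: S1|exact: S2|exact: sumd].
  rewrite -subr_ge0 (_ : _ - _ = 2 * L) ?mulr_ge0 ?addr_ge0//.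
  by rewrite /L /x; ring.
Unshelve. all: by end_near. Qed.

(** * Expansion of the kernel *)

Section cis.
Context {R : realType}.
Local Open Scope complex_scope.
Local Notation RC := (real_complex R).

Definition cis (t : R) : R[i] := cos t +i* sin t.

Lemma cisD a b : cis (a + b) = cis a * cis b.
Proof. by rewrite /cis cosD sinD; apply/eqP; rewrite eq_complex/= [in X in _ && X]addrC !eqxx. Qed.

Lemma cis0 : cis 0 = 1.
Proof. by rewrite /cis cos0 sin0. Qed.

Lemma cisN_mul t : cis (- t) * cis t = 1.
Proof. by rewrite -cisD addNr cis0. Qed.

Lemma cis_neq0 t : cis t != 0.
Proof. by apply: contra_neq (oner_neq0 R[i]) => ct; rewrite -(cisN_mul t) ct mulr0. Qed.

Lemma cisN t : cis (- t) = (cis t)^-1.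
Proof. by apply: (mulIf (cis_neq0 t)); rewrite cisN_mul mulVf// cis_neq0. Qed.

Lemma cis_nat n t : cis (n%:R * t) = cis t ^+ n.
Proof.
elim: n => [|n IH]; first by rewrite mul0r cis0 expr0.
by rewrite -natr1 mulrDl mul1r cisD IH exprSr.
Qed.

Lemma norm_cis t : `|cis t| = 1.
Proof. by rewrite normc_def/= cos2Dsin2 sqrtr1. Qed.

(** By the half-angle formula [sin (|x| / 2)] would vanish strictly between 0 and [pi]. It ensures
    that distinct parameters of one period give distinct points of the unit circle. *)
Lemma cis_eq_small x : `|x| < 2 * pi -> cis x = 1 -> x = 0.
Proof.
move=> xpi [cx _].
apply: contraTeq isT => x0; have y0 : 0 < `|x| / 2 by rewrite divr_gt0// normr_gt0.
have ypi : `|x| / 2 < pi by rewrite ltr_pdivrMr// mulrC.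
have := @sin_gt0_pi R (`|x| / 2); rewrite y0 ypi => /(_ isT) sy.
have := cos_mulr2n (`|x| / 2); rewrite [in LHS]mulr2n -splitr cos_norm cx => c2.
have : sin (`|x| / 2) ^+ 2 = 0 by rewrite sin2cos2; lra.
by move=> /eqP; rewrite sqrf_eq0 gt_eqF.
Qed.

Lemma le_Im (x : R[i]) (b : R) : `|x| <= RC b -> `|complex.Im x| <= b.
Proof.
rewrite normc_def lecR; apply: le_trans.
by rewrite -sqrtr_sqr ler_wsqrtr// lerDr sqr_ge0.
Qed.

End cis.

Section sigpoly_horner.
Implicit Types (n m Q : nat).

Lemma sigpoly_X1 (A : comNzRingType) m :
  ('X - 1) * sigpoly A m = 'X * ('X^m - 1).
Proof.
rewrite subrX1 mulrCA; congr (_ * _); rewrite mulr_sumr.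
by apply: eq_bigr => i _; rewrite exprS.
Qed.

Lemma sigpoly_horner (A : comNzRingType) m (x : A) :
  (x - 1) * (sigpoly A m).[x] = x * (x ^+ m - 1).
Proof. by have := congr1 (horner^~ x) (sigpoly_X1 A m); rewrite !hornerE. Qed.

(** Obtained by differentiating [(X - 1) sigpoly = X (X^m - 1)]. It is the identity behind
    [V_factor]. *)
Lemma sigpoly_deriv_horner (A : comNzRingType) m (x : A) :
  (sigpoly A m).[x] - x * (1 - x) * (sigpoly A m)^`().[x] = m%:R * x ^+ m.+1.
Proof.
have := congr1 (fun p => p^`().[x]) (sigpoly_X1 A m).
rewrite !derivM !derivB !derivX derivXn -[1]/(1%:P) !derivC !subr0.
rewrite !hornerE/= hornerMn hornerXn => e1.
have e2 := sigpoly_horner m x.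
have -> : m%:R * x ^+ m.+1 = x * (x * (x ^+ m.-1 *+ m)).
  by case: m {e1 e2} => [|m]; rewrite ?mulr0n ?mul0r ?mulr0// !exprS -mulr_natl; ring.
move: e1 e2; set p := (sigpoly A m).[x]; set p' := _.[x]; set y := x ^+ m.-1 *+ m.
move=> e1 e2; have -> : p - x * (1 - x) * p' = x * (p + (x - 1) * p') - (x - 1) * p by ring.
rewrite e2. rewrite e1; ring.
Qed.

Lemma derivXM_horner (A : comNzRingType) (p : {poly A}) Q (x : A) :
  (size p <= Q)%N -> x * p^`().[x] = \sum_(i < Q) i%:R * p`_i * x ^+ i.
Proof.
move=> pQ; have -> : x * p^`().[x] = ('X * p^`()).[x] by rewrite hornerM hornerX.
rewrite (@horner_coef_wide _ Q).
  apply: eq_bigr => -[[|i] iQ] _ /=; rewrite coefXM/= ?mul0r//.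
  by rewrite coef_deriv mulr_natl.
apply/leq_sizeP => -[|i] Qi; rewrite coefXM//= coef_deriv nth_default ?mul0rn//.
exact: leq_trans pQ Qi.
Qed.

End sigpoly_horner.

Section kernel_expansion.
Context {R : realType}.
Local Open Scope complex_scope.
Local Notation RC := (real_complex R).

Lemma sigpoly_complex m n p :
  (sigpoly R[i] m ^+ n)`_p = RC (sigpoly R m ^+ n)`_p.
Proof.
have -> : sigpoly R[i] m = map_poly RC (sigpoly R m).
  rewrite rmorph_sum; by apply: eq_bigr => i _; rewrite /= map_polyXn.
by rewrite -rmorphXn coef_map.
Qed.

Lemma ReZ (r : R) (z : R[i]) : complex.Re (RC r * z) = r * complex.Re z.
Proof. by case: z => a b /=; rewrite mul0r subr0. Qed.

Lemma Re_sum (I : finType) (F : I -> R[i]) : complex.Re (\sum_i F i) = \sum_i complex.Re (F i).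
Proof. by apply: (big_morph (@complex.Re R)) => [[a b] [c e]|]. Qed.

(** The quotient is [1 / (1 - x)] with [x] on the unit circle, and this map sends the circle to the
    line of real part 1/2. This is the kernel of the disc. *)
Lemma Re_cis_quotient (t s : R) : cis t != cis s ->
  complex.Re (cis t / (cis t - cis s)) = 2^-1.
Proof.
move=> ts; have := cos2Dsin2 t; have := cos2Dsin2 s; move: ts.
rewrite /cis; move: (cos t) (sin t) (cos s) (sin s) => a b c e ts ce ab.
have n0 : (a - c) ^+ 2 + (b - e) ^+ 2 != 0.
  apply: contra_neq ts => /eqP; rewrite paddr_eq0 ?sqr_ge0// !sqrf_eq0 !subr_eq0.
  by move=> /andP[/eqP -> /eqP ->].
rewrite /= -[- c]/(- c) mulrN opprK.
have -> : a * ((a - c) / ((a - c) ^+ 2 + (b - e) ^+ 2)) +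
          b * ((b - e) / ((a - c) ^+ 2 + (b - e) ^+ 2)) =
    (a * (a - c) + b * (b - e)) / ((a - c) ^+ 2 + (b - e) ^+ 2) by field.
apply: (mulIf n0); rewrite divfK//.
have -> : (a - c) ^+ 2 + (b - e) ^+ 2 = (a ^+ 2 + b ^+ 2) + (c ^+ 2 + e ^+ 2) - 2 * (a * c + b * e) by ring.
have -> : a * (a - c) + b * (b - e) = (a ^+ 2 + b ^+ 2) - (a * c + b * e) by ring.
by rewrite ab ce; field.
Qed.

Lemma geometric_remainder (F : fieldType) (y : F) M : y != 1 ->
  (1 - y)^-1 = \sum_(n < M) y ^+ n + y ^+ M / (1 - y).
Proof.
move=> y1; have h : 1 - y != 0 by rewrite subr_eq0 eq_sym.
apply: (mulfI h); rewrite mulfV// mulrDr mulrCA mulfV// mulr1.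
by rewrite -opprB mulNr -subrX1 opprB subrK.
Qed.

Variables (rho0 : R) (m : nat) (d : R).
Hypothesis hd : m%:R * `|d| <= 2^-1.

(** [J] is [exp rho0 * |1 - m d exp(- i (m + 1) t)|], and the modulus lies within [m |d| <= 1/2] of
    1. *)
Lemma J_bounds t : expR rho0 / 2 <= J rho0 m d t <= 2 * expR rho0.
Proof.
have e0 := expR_gt0 rho0.
rewrite /J /speed velocity_bdry /dotp/=.
set A := - sin t - _; set B := cos t - _.
have -> : expR rho0 * A * (expR rho0 * A) + expR rho0 * B * (expR rho0 * B) =
  expR rho0 ^+ 2 * (A ^+ 2 + B ^+ 2) by ring.
rewrite sqrtrM ?sqr_ge0// sqrtr_sqr gtr0_norm//.
have -> : A ^+ 2 + B ^+ 2 = 1 + (d * m%:R) ^+ 2 - 2 * (d * m%:R) * cos (t + m%:R * t).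
  rewrite cosD; have -> : A ^+ 2 + B ^+ 2 = (cos t ^+ 2 + sin t ^+ 2) +
      (d * m%:R) ^+ 2 * (cos (m%:R * t) ^+ 2 + sin (m%:R * t) ^+ 2) -
      2 * (d * m%:R) * (cos t * cos (m%:R * t) - sin t * sin (m%:R * t)).
    by rewrite /A /B; ring.
  by rewrite !cos2Dsin2 mulr1.
have a2 : `|d * m%:R| <= 2^-1 by rewrite normrM normr_nat mulrC.
have := cos_max (t + m%:R * t); move: a2; set c := cos _; set a := d * _.
move=> a2 c1; have : `|a * c| <= `|a| by rewrite normrM ler_piMr.
rewrite ler_norml => /andP[ac1 ac2].
rewrite -mulrA -(real_normK (num_real a)).
move: (normr_ge0 a) a2 ac1 ac2; move: `|a| (a * c) => {c1}n p n0 n2 p1 p2.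
have lo : 2^-1 ^+ 2 <= 1 + n ^+ 2 - 2 * p by nra.
have hi : 1 + n ^+ 2 - 2 * p <= 2 ^+ 2 by nra.
apply/andP; split.
  rewrite ler_wpM2l ?(ltW e0)//; have -> : 2^-1 = Num.sqrt (2^-1 ^+ 2) :> R.
    by rewrite sqrtr_sqr ger0_norm.
  by rewrite ler_wsqrtr.
rewrite mulrC ler_wpM2r ?(ltW e0)//.
apply: (@le_trans _ _ (Num.sqrt (2 ^+ 2))); first by rewrite ler_wsqrtr.
by rewrite sqrtr_sqr ger0_norm.
Qed.

Lemma J_gt0 t : 0 < J rho0 m d t.
Proof.
have /andP[+ _] := J_bounds t; apply: lt_le_trans.
by rewrite divr_gt0// expR_gt0.
Qed.

(** [V t] is [z'(t)] and [W t s] the chord [z(t) - z(s)]. The scale [exp rho0] is left out since it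
    cancels in [J * NP_kernel]. *)
Let V t := 'i * (cis t - RC d * m%:R * cis t ^- m).
Let W t s := cis t + RC d * cis t ^- m - (cis s + RC d * cis s ^- m).

(** The outward normal is [- i V / |V|], so [<W, nu> / |W|^2 = Im (V / W) / |V|], and the speed
    cancels [|V|]. *)
Lemma J_NP_kernel t s : W t s != 0 ->
  J rho0 m d t * NP_kernel (bdry rho0 m d) t s = complex.Im (V t / W t s).
Proof.
have e0 := expR_gt0 rho0; have J0 := J_gt0 t.
rewrite /NP_kernel /outward_normal -/(J rho0 m d t) velocity_bdry /dotp/=.
rewrite /V /W -!exprVn -!cisN -!cis_nat.
have -> : RC d * m%:R = RC (d * m%:R) by rewrite rmorphM/= rmorph_nat.
rewrite /cis !mulrN !cosN !sinN; move: (J rho0 m d t) J0 => j j0.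
move: (cos t) (sin t) (cos s) (sin s) (cos (m%:R * t)) (sin (m%:R * t))
  (cos (m%:R * s)) (sin (m%:R * s)) => a b a' b' c f c' f'.
rewrite /= !(mul0r, mul1r, subr0, add0r, addr0, sub0r) !mulrN !opprK => Wn.
have -> : expR rho0 * (a + d * c) - expR rho0 * (a' + d * c') =
  expR rho0 * (a + d * c - (a' + d * c')) by ring.
have -> : expR rho0 * (b - d * f) - expR rho0 * (b' - d * f') =
  expR rho0 * (b - d * f - (b' - d * f')) by ring.
have : (a + d * c - (a' + d * c')) ^+ 2 + (b - d * f - (b' - d * f')) ^+ 2 != 0.
  apply: contra_neq Wn => /eqP; rewrite paddr_eq0 ?sqr_ge0// !sqrf_eq0.
  move=> /andP[/eqP x1 /eqP x2]; apply/eqP; rewrite eq_complex/=.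
  by rewrite !(mul0r, subr0, add0r, addr0, sub0r) !mulrN x1 x2 !eqxx.
move: (a + d * c - (a' + d * c')) (b - d * f - (b' - d * f')) => X Y.
move: (expR rho0) e0 => E E0.
have -> : E * X * (E * X) + E * Y * (E * Y) = E ^+ 2 * (X ^+ 2 + Y ^+ 2) by ring.
by move: (X ^+ 2 + Y ^+ 2) => N N0; field; rewrite N0 !gt_eqF.
Qed.

Lemma W_factor t s : W t s = (cis t - cis s) *
  (1 - RC d * (cis s ^- m.+1 * (sigpoly R[i] m).[cis s / cis t])).
Proof.
have z0 := cis_neq0 t; have e0 := cis_neq0 s.
rewrite /W; move: (cis t) (cis s) z0 e0 (sigpoly_horner m (cis s / cis t)) => z e z0 e0.
set g := _.[_]; rewrite expr_div_n => h.
have zg : (z - e) * g = - (e * (e ^+ m / z ^+ m - 1)).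
  have -> : (z - e) * g = - (z * ((e / z - 1) * g)) by field.
  by rewrite h; field; rewrite z0 expf_neq0.
have -> : (z - e) * (1 - RC d * (e ^- m.+1 * g)) =
  z - e - RC d * e ^- m.+1 * ((z - e) * g) by ring.
rewrite zg exprS; move: (expf_neq0 m z0) (expf_neq0 m e0).
by move: (z ^+ m) (e ^+ m) => zm em zm0 em0; field; rewrite zm0 em0 e0.
Qed.

(** This is the product rule applied to [W_factor], with [dx/dt = - i x]; dividing by [W] gives the
    logarithmic derivative. It is checked algebraically. *)
Lemma V_factor t s : let x := cis s / cis t in let h := cis s ^- m.+1 in
  V t = 'i * cis t * (1 - RC d * (h * (sigpoly R[i] m).[x])) +
     'i * (RC d * h * (x * (sigpoly R[i] m)^`().[x])) * (cis t - cis s).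
Proof.
have z0 := cis_neq0 t; have e0 := cis_neq0 s; rewrite /V /=.
move: (cis t) (cis s) z0 e0 (sigpoly_deriv_horner m (cis s / cis t)) => z e z0 e0.
set g := (sigpoly _ _).[_]; set g' := _^`().[_] => h.
have -> : 'i * z * (1 - RC d * (e ^- m.+1 * g)) +
    'i * (RC d * e ^- m.+1 * (e / z * g')) * (z - e) =
    'i * z * (1 - RC d * e ^- m.+1 * (g - e / z * (1 - e / z) * g')).
  by rewrite exprS; move: (expf_neq0 m e0) => em0; field; rewrite z0 e0 em0.
rewrite h expr_div_n !exprS; move: (expf_neq0 m z0) (expf_neq0 m e0).
by move: (z ^+ m) (e ^+ m) => zm em zm0 em0; field; rewrite zm0 em0 e0 z0.
Qed.

(** Truncation of the expansion in [d]. The range of [p] is common to all [n < M]: since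
    [(n + 1) m <= M m], no nonzero term is lost. *)
Definition NP_partial (M : nat) (t s : R) : R :=
  2^-1 + 2 * d * \sum_(n < M) d ^+ n * \sum_(p < (M * m).+1)
    grunsky m n p * cos (p%:R * t + (n.+1 * m.+1 - p)%:R * s).

(** With [y = d S], the remainder of the geometric series is [d h x g' y^M / (1 - y)] up to a factor
    [i], where [|g'| <= m^2], [|y| <= m |d|] and [|1 - y| >= 1/2]. *)
Lemma NP_kernel_expansion M t s : cis t != cis s ->
  `|J rho0 m d t * NP_kernel (bdry rho0 m d) t s - NP_partial M t s| <=
    2 * `|d| * m%:R ^+ 2 * (m%:R * `|d|) ^+ M.
Proof.
move=> ts; pose x := cis s / cis t; pose h := cis s ^- m.+1.
pose g := (sigpoly R[i] m).[x]; pose g' := (sigpoly R[i] m)^`().[x].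
have x1 : `|x| = 1 by rewrite normrM normfV !norm_cis divr1.
have h1 : `|h| = 1 by rewrite normfV normrX norm_cis expr1n invr1.
have xn n : `|x ^+ n| = 1 by rewrite normrX x1 expr1n.
have gm : `|g| <= m%:R.
  rewrite /g /sigpoly horner_sum (le_trans (ler_norm_sum _ _ _))//.
  have -> : m%:R = \sum_(i < m) 1 :> R[i] by rewrite sumr_const card_ord.
  apply: ler_sum => i _.
  by rewrite hornerXn xn.
have g'm : `|g'| <= m%:R ^+ 2.
  rewrite /g' /sigpoly raddf_sum horner_sum (le_trans (ler_norm_sum _ _ _))//.
  have -> : m%:R ^+ 2 = \sum_(i < m) m%:R :> R[i] by rewrite sumr_const card_ord expr2 mulr_natl.
  apply: ler_sum => i _.
  by rewrite /= derivXn hornerMn hornerXn normrMn xn ler_nat.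
pose y := RC d * (h * g).
have dn : `|RC d| = RC `|d| by rewrite normc_def/= expr0n addr0 sqrtr_sqr.
have ym : `|y| <= RC (m%:R * `|d|).
  rewrite /y !normrM h1 mul1r dn rmorphM/= rmorph_nat mulrC ler_wpM2r//.
  by rewrite lecR.
have yh : RC 2^-1 <= `|1 - y|.
  apply: le_trans (lerB_dist _ _); rewrite normr1 lerBrDr (le_trans (lerD (lexx _) ym))//.
  rewrite -rmorphD/= -(rmorph1 RC) lecR; move: (m%:R * `|d|) hd => z; lra.
have y1 : 1 - y != 0.
  by rewrite -normr_gt0 (lt_le_trans _ yh)// ltcR.
have W0 : W t s != 0 by rewrite W_factor mulf_neq0// subr_eq0.
have VW : V t / W t s = 'i * (cis t / (cis t - cis s)) +
   'i * (RC d * h * (x * g') / (1 - y)).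
  rewrite (V_factor t s) W_factor -/x -/h -/g -/g' -/y.
  by field; rewrite y1 subr_eq0.
have y1' : y != 1 by apply: contra_neq y1 => ->; rewrite subrr.
pose rem := 'i * (RC d * h * (x * g') * (y ^+ M / (1 - y))).
have tE n p : (p <= n.+1 * m)%N ->
    h ^+ n.+1 * x ^+ p = cis (- (p%:R * t + (n.+1 * m.+1 - p)%:R * s)).
  move=> pn; have pN : (p <= n.+1 * m.+1)%N by rewrite (leq_trans pn)// leq_mul2l leqnSn orbT.
  rewrite /h /x -cis_nat -!cisN -cisD -!cis_nat -cisD natrB// natrM; congr cis; ring.
(* Since [x (sigpoly^(n+1))' = (n + 1) x g' g^n], expanding the left side in powers of [x] produces
   [p / (n + 1)], hence twice [grunsky]. *)
have sE n : (n < M)%N -> h * (x * g') * y ^+ n =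
    \sum_(p < (M * m).+1) RC (d ^+ n * (2 * grunsky m n p)) * (h ^+ n.+1 * x ^+ p).
  move=> nM; have : (size (sigpoly R[i] m ^+ n.+1) <= (M * m).+1)%N.
    by rewrite (leq_trans (size_sigpoly_exp _ _ _))// ltnS leq_mul2r nM orbT.
  move=> /(derivXM_horner x); rewrite deriv_exp/= hornerMn hornerM horner_exp -/g -/g'.
  rewrite -mulr_natl => e.
  have n0 : n.+1%:R != 0 :> R[i] by rewrite pnatr_eq0.
  have -> : h * (x * g') * y ^+ n =
      RC d ^+ n * h ^+ n.+1 / n.+1%:R * (x * (n.+1%:R * (g' * g ^+ n))).
    by rewrite /y !exprMn exprS; field.
  rewrite e mulr_sumr; apply: eq_bigr => p _; rewrite sigpoly_complex /grunsky.
  rewrite !(rmorphM, rmorphXn, fmorphV)/= !rmorph_nat.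
  by field.
rewrite J_NP_kernel// VW (geometric_remainder M y1').
have -> : 'i * (cis t / (cis t - cis s)) +
    'i * (RC d * h * (x * g') * (\sum_(n < M) y ^+ n + y ^+ M / (1 - y))) =
  (cis t / (cis t - cis s) + RC d * \sum_(n < M) (h * (x * g') * y ^+ n)) * 'i + rem.
  by rewrite -mulr_sumr /rem; ring.
have -> : forall a b : R[i], complex.Im (a * 'i + b) = complex.Re a + complex.Im b.
  by move=> a b; rewrite -ImiRe; case: (a * 'i) b => ? ? [].
have -> : forall a b : R[i], complex.Re (a + b) = complex.Re a + complex.Re b.
  by move=> [? ?] [].
rewrite Re_cis_quotient// ReZ Re_sum.
have -> : \sum_(n < M) complex.Re (h * (x * g') * y ^+ n) =
    2 * \sum_(n < M) d ^+ n * \sum_(p < (M * m).+1)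
      grunsky m n p * cos (p%:R * t + (n.+1 * m.+1 - p)%:R * s).
  rewrite mulr_sumr; apply: eq_bigr => n _; rewrite (sE n (ltn_ord n)) Re_sum.
  rewrite !mulr_sumr; apply: eq_bigr => p _; rewrite ReZ.
  have [pn|np] := leqP p (n.+1 * m); last by rewrite grunsky_eq0// !(mulr0, mul0r).
  by rewrite tE// /cis/= cosN; ring.
rewrite /NP_partial (_ : _ - _ = complex.Im rem); last by ring.
apply: le_Im.
rewrite /rem; move: h1 x1 g'm ym yh y1; move: (h) (x) (g') (y).
move=> h0 x0 g0 y0 h01 x01 g0m y0m y0h y01.
rewrite !normrM normfV normrX h01 x01 dn !mul1r mulr1.
have -> : `|'i : R[i]| = 1 by rewrite normc_def/= expr0n/= add0r expr1n sqrtr1.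
rewrite mul1r.
have -> : RC (2 * `|d| * m%:R ^+ 2 * (m%:R * `|d|) ^+ M) =
    RC `|d| * m%:R ^+ 2 * (RC (m%:R * `|d|) ^+ M * RC 2).
  by rewrite !rmorphM/= !rmorphXn/= !rmorphM/= !rmorph_nat; ring.
have RC0 : 0 <= RC `|d| by rewrite lecR.
apply: ler_pM; rewrite ?mulr_ge0 ?invr_ge0 ?exprn_ge0//; first by rewrite ler_wpM2l.
apply: ler_pM; rewrite ?invr_ge0 ?exprn_ge0//; first by rewrite lerXn2r ?nnegrE// lecR mulr_ge0.
rewrite -[leRHS]invrK lef_pV2 ?posrE ?normr_gt0// ?invr_gt0 ?ltcR//.
by rewrite -fmorphV.
Qed.

End kernel_expansion.

(** * Integration against arc length *)

Section integral_density.
Context d (T : measurableType d) (R : realType).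
Variables (mu nu : {measure set T -> \bar R}) (f : T -> R).
Hypotheses (mf : measurable_fun setT f) (f0 : forall x, 0 <= f x).
Hypothesis nuE : forall A, measurable A -> nu A = (\int[mu]_(x in A) (f x)%:E)%E.
Local Open Scope ereal_scope.
Import HBNNSimple.

(** Both sides are monotone limits along simple approximations of [g]; for indicators the identity
    is [nuE]. *)
Lemma ge0_integral_density (g : T -> \bar R) :
  measurable_fun setT g -> (forall x, 0 <= g x) ->
  \int[nu]_x g x = \int[mu]_x (g x * (f x)%:E).
Proof.
move=> mg g0; have mfE : measurable_fun setT (EFin \o f) by exact/measurable_EFinP.
have fE0 x : 0 <= (f x)%:E by rewrite lee_fin.
pose h := nnsfun_approx measurableT mg.
transitivity (lim (\int[nu]_x (h n x)%:E @[n --> \oo])).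
  rewrite -monotone_convergence//=.
  - apply: eq_integral => x _; apply/esym/cvg_lim => //.
    exact: cvg_nnsfun_approx.
  - by move=> n; exact/measurable_EFinP/measurable_funTS.
  - by move=> n x _; rewrite lee_fin.
  - by move=> x _ a b ab; rewrite lee_fin; exact/lefP/nd_nnsfun_approx.
transitivity (lim (\int[mu]_x ((h n x)%:E * (f x)%:E) @[n --> \oo])); last first.
  rewrite -monotone_convergence//=.
  - apply: eq_integral => x _; apply/cvg_lim => //.
    by apply: cvgeZr => //; exact: cvg_nnsfun_approx.
  - move=> n; apply: emeasurable_funM => //.
    exact/measurable_EFinP/measurable_funTS.
  - by move=> n x _; rewrite mule_ge0// lee_fin.
  - move=> x _ a b ab; rewrite lee_wpmul2r// lee_fin.
    exact/lefP/nd_nnsfun_approx.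
apply: congr_lim; apply/funext => n; move: (h n) => {h g mg g0 n} h.
under [LHS]eq_integral do rewrite fimfunE -fsumEFin//.
rewrite [LHS]ge0_integral_fsum//; last 2 first.
  - by move=> r; exact/measurable_EFinP/measurableT_comp.
  - by move=> r x _; rewrite EFinM nnfun_muleindic_ge0.
under [RHS]eq_integral.
  move=> x xD; rewrite fimfunE -fsumEFin// ge0_mule_fsuml; last first.
    by move=> r; rewrite EFinM nnfun_muleindic_ge0.
  over.
rewrite [RHS]ge0_integral_fsum//; last 2 first.
  - move=> r; apply: emeasurable_funM => //.
    exact/measurable_EFinP/measurableT_comp.
  - by move=> r x _; rewrite mule_ge0// EFinM nnfun_muleindic_ge0.
apply: eq_fsbigr => r rh; rewrite integralZl_indic_nnsfun// integral_indic// setIT.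
rewrite nuE//; under [RHS]eq_integral do rewrite EFinM -muleA.
rewrite ge0_integralZl//.
- congr (_ * _); rewrite [LHS]integral_mkcond; apply: eq_integral => x _.
  by rewrite patchE indicE; case: ifPn => _; rewrite ?mul1e ?mul0e.
- by apply: emeasurable_funM => //; exact/measurable_EFinP.
- by move=> x _; rewrite mule_ge0// lee_fin.
- by move: rh; rewrite inE => -[x _ <-]; rewrite lee_fin.
Qed.

(** Multiplication by [f >= 0] commutes with positive and negative parts, so no integrability of [g]
    is involved. *)
Lemma integral_density (g : T -> \bar R) :
  measurable_fun setT g -> \int[nu]_x g x = \int[mu]_x (g x * (f x)%:E).
Proof.
move=> mg; rewrite [LHS]integralE [RHS]integralE.
rewrite !ge0_integral_density//; [|exact: measurable_funeneg|exact: measurable_funepos].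
congr (_ - _); apply: eq_integral => x _; rewrite muleC.
- have := congr1 (fun h => h x) (ge0_funeposM g (f0 x)).
  by rewrite unlock => <-; rewrite muleC.
- have := congr1 (fun h => h x) (ge0_funenegM g (f0 x)).
  by rewrite unlock => <-; rewrite muleC.
Qed.

End integral_density.

Section sigma_measure.
Context {R : realType} (rho0 : R) (m : nat) (d : R).
Hypothesis hd : m%:R * `|d| <= 2^-1.
Local Notation J := (J rho0 m d).
Local Notation sigma := (sigma rho0 m d).
Local Notation leb := (@lebesgue_measure R).

Lemma measurable_J : measurable_fun setT J.
Proof. apply: continuous_measurable_fun; exact: continuous_J. Qed.

Lemma integral_sigma (g : R -> \bar R) : measurable_fun setT g ->
  (\int[sigma]_t g t = \int[leb]_(t in @period R) (g t * (J t)%:E))%E.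
Proof.
move=> mg; rewrite (@integral_density _ _ _ leb sigma (J \_ period))//.
- rewrite [RHS]integral_mkcond; apply: eq_integral => t _.
  rewrite !patchE; case: ifPn => // _; exact: mule0.
- apply/(measurable_restrictT _ _).1; first exact: measurable_itv.
  by apply: measurable_funTS; exact: measurable_J.
- by move=> t; rewrite patchE; case: ifPn => _; [exact: sqrtr_ge0|exact: lexx].
- move=> A mA; rewrite [LHS]integral_mkcondr; apply: eq_integral => t _.
  by rewrite !patchE; case: ifPn.
Qed.

Lemma Rintegral_sigma (g : R -> R) : measurable_fun setT g ->
  \int[sigma]_t g t = \int[leb]_(t in @period R) (g t * J t).
Proof. by move=> mg; rewrite /Rintegral integral_sigma//; exact/measurable_EFinP. Qed.

Lemma lebesgue_period : leb (@period R) = (2 * pi)%:E.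
Proof.
by rewrite /period lebesgue_measure_itv/= lte_fin mulr_gt0 ?pi_gt0// oppr0 adde0.
Qed.

Lemma sigma_setT : (sigma setT <= (2 * expR rho0 * (2 * pi))%:E)%E.
Proof.
have -> : sigma setT = (\int[leb]_(t in @period R) (J t)%:E)%E.
  by rewrite /sigma/= /Defs.sigma setTI.
apply: (@le_trans _ _ (\int[leb]_(t in @period R) (2 * expR rho0)%:E)%E).
  apply: ge0_le_integral => //=.
  - exact: measurable_itv.
  - by move=> t _; rewrite lee_fin sqrtr_ge0.
  - by apply/measurable_EFinP; apply: measurable_funTS; exact: measurable_J.
  - by move=> t _; rewrite lee_fin; have /andP[] := J_bounds rho0 hd t.
rewrite integral_cst; last exact: measurable_itv.
by rewrite [X in (_ * X)%E]lebesgue_period.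
Qed.

(** Square root of an upper bound for the length of the curve; it converts sup bounds into L2
    bounds. *)
Definition L2const : R := Num.sqrt (2 * expR rho0 * (2 * pi)).

Lemma L2norm_bounded (f : R -> R) (B : R) : measurable_fun setT f ->
  (forall t, `|f t| <= B) -> (L2norm rho0 m d f <= (B * L2const)%:E)%E.
Proof.
move=> mf fB; have B0 : 0 <= B by exact: le_trans (fB 0).
rewrite /L2norm unlock.
have h : (\int[sigma]_x (`|(EFin \o f) x| `^ 2) <= (B ^+ 2 * (2 * expR rho0 * (2 * pi)))%:E)%E.
  apply: (@le_trans _ _ (\int[sigma]_x (B ^+ 2)%:E)%E).
    apply: ge0_le_integral => //=.
    - apply/measurable_EFinP; apply: (measurableT_comp (measurable_powR _)).
      exact: measurableT_comp.
    - by move=> t _; rewrite lee_fin powR_mulrn// lerXn2r// nnegrE.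
  rewrite integral_cst// [leRHS]EFinM lee_wpmul2l//; first by rewrite lee_fin exprn_ge0.
  exact: sigma_setT.
apply: (@le_trans _ _ ((B ^+ 2 * (2 * expR rho0 * (2 * pi)))%:E `^ 2^-1)%E).
  apply: gt0_ler_poweR => //.
  - by rewrite in_itv/= leey andbT; apply: integral_ge0 => t _ /=; rewrite lee_fin powR_ge0.
  - by rewrite in_itv/= leey andbT lee_fin !mulr_ge0// ?expR_ge0 ?pi_ge0.
rewrite poweR_EFin lee_fin powR12_sqrt; last first.
  by rewrite !mulr_ge0// ?expR_ge0 ?pi_ge0.
by rewrite sqrtrM ?sqr_ge0// sqrtr_sqr ger0_norm.
Qed.

Lemma integrable_period (f : R -> R) (B : R) : measurable_fun setT f ->
  (forall t, period t -> `|f t| <= B) -> leb.-integrable (@period R) (EFin \o f).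
Proof.
move=> mf fB; apply: measurable_bounded_integrable.
- exact: measurable_itv.
- by rewrite [X in (X < _)%E]lebesgue_period ltry.
- exact: measurable_funTS.
- exists B; split; first exact: num_real.
  by move=> x Bx t pt /=; rewrite (le_trans (fB _ pt))// ltW.
Qed.

(* The exceptional point is the diagonal of the kernel, where it is 0 / 0 = 0. *)
Lemma Rintegral_period_le (f : R -> R) (B t0 : R) : measurable_fun setT f ->
  (forall t, period t -> t != t0 -> `|f t| <= B) ->
  `|\int[leb]_(t in @period R) f t| <= B * (2 * pi).
Proof.
move=> mf fB; pose D : set (measurableTypeR R) := period `\ t0.
have mp : measurable (@period R : set (measurableTypeR R)) by exact: measurable_itv.
have mD : measurable D by exact: measurableD.
have DE (g : R -> R) : measurable_fun setT g ->
    \int[leb]_(t in @period R) g t = \int[leb]_(t in D) g t.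
  move=> mg; rewrite /Rintegral [in RHS]integral_setD1//.
  by apply/measurable_EFinP; exact: measurable_funTS.
have Di (g : R -> R) : measurable_fun setT g -> (forall t, D t -> `|g t| <= B) ->
    leb.-integrable D (EFin \o g).
  move=> mg gB; apply: measurable_bounded_integrable => //.
  - apply: (@le_lt_trans _ _ (leb (@period R))).
      by apply: le_measure; rewrite ?inE//; exact: subDsetl.
    by rewrite lebesgue_period ltry.
  - exact: measurable_funTS.
  - exists B; split; first exact: num_real.
    by move=> x Bx t Dt /=; rewrite (le_trans (gB _ Dt))// ltW.
have fD t : D t -> `|f t| <= B by move=> [pt /eqP tt0]; exact: fB.
(* A point of the period other than [t0] is required: 0, or [pi] if [t0 = 0]. *)
have B0 : 0 <= B.
  have pi2 : pi < 2 * pi :> R by rewrite ltr_pMl ?pi_gt0// ltr1n.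
  have [t00|t00] := eqVneq 0 t0.
    apply: le_trans (fB pi _ _) => //; last by rewrite -t00 gt_eqF// pi_gt0.
    by rewrite /period/= in_itv/= pi_ge0.
  apply: le_trans (fB 0 _ t00) => //.
  by rewrite /period/= in_itv/= lexx mulr_gt0// pi_gt0.
have <- : \int[leb]_(t in D) B = B * (2 * pi).
  by rewrite -DE// Rintegral_cst// [X in fine X]lebesgue_period.
rewrite DE// (le_trans (le_normr_Rintegral mD (Di _ mf fD)))//.
apply: le_Rintegral => //.
- by apply: Di => [|t Dt]; [exact: measurableT_comp|rewrite normr_id fD].
- by apply: Di => // t _; rewrite ger0_norm.
Qed.

Lemma continuous_affine_arg (f : R -> R) (a k : R) : continuous f ->
  continuous (fun s => f (a + k * s)).
Proof.
move=> cf s; apply: (@continuous_comp _ _ _ (fun s => a + k * s) f); last exact: cf.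
apply: continuousD; first exact: cvg_cst.
by apply: continuousM; [exact: cvg_cst|exact: cvg_id].
Qed.

Lemma measurable_cos_affine (a k : R) : measurable_fun setT (fun s => cos (a + k * s)).
Proof.
apply: continuous_measurable_fun; apply: continuous_affine_arg.
exact: continuous_cos.
Qed.

Lemma sinD_int_period (a : R) (k : int) : sin (a + k%:~R * (2 * pi)) = sin a.
Proof.
have nat_period (b : R) (n : nat) : sin (b + n%:R * (2 * pi)) = sin b.
  by rewrite !mulr_natl; exact: (periodicn (@sinD2pi R)).
case: k => n; first exact: nat_period.
by rewrite NegzE mulrNz mulNr -[LHS](nat_period _ n.+1) subrK.
Qed.

Lemma Rintegral_period_cos (a : R) (k : int) : k != 0 ->
  \int[leb]_(s in @period R) cos (a + k%:~R * s) = 0.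
Proof.
move=> k0; have kR : k%:~R != 0 :> R by rewrite intr_eq0.
have pi20 : 0 < 2 * pi :> R by rewrite mulr_gt0// pi_gt0.
pose F (s : R) := k%:~R^-1 * sin (a + k%:~R * s).
have Fd (s : R) : is_derive s (1 : R) F (cos (a + k%:~R * s)).
  have d1 : is_derive s (1 : R) (fun s : R => a + k%:~R * s) (k%:~R : R).
    have := is_deriveD (is_derive_cst a s (1 : R))
      (is_deriveZ (k%:~R : R) (is_derive_id s (1 : R))).
    by rewrite /GRing.scale /= mulr1 add0r.
  have := is_deriveZ (k%:~R^-1 : R) (@is_derive1_comp _ sin (fun s => a + k%:~R * s) s _ _ (is_derive_sin _) d1).
  by rewrite /GRing.scale/= mulrCA mulVf// mulr1.
have cF : continuous F.
  move=> s; have [/derivable1_diffP/differentiable_continuous] := Fd s; exact.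
rewrite /period Rintegral_itv_bndo_bndc; last first.
  apply: (@integrable_period _ 1); first exact: measurable_cos_affine.
  by move=> t _; exact: cos_max.
rewrite /Rintegral (@continuous_FTC2 _ _ F)//.
- by rewrite /F/= sinD_int_period mulr0 addr0 subrr.
- apply: continuous_subspaceT; apply: continuous_affine_arg; exact: continuous_cos.
- split.
  + by move=> x _; have [] := Fd x.
  + by apply: cvg_at_right_filter; exact: cF.
  + by apply: cvg_at_left_filter; exact: cF.
- by move=> x _; rewrite derive1E; have [] := Fd x.
Qed.

End sigma_measure.

(** * Cosine series *)

Lemma measurable_fun_inv_ge0 d (T : measurableType d) (R : realType) (f : T -> R) :
  measurable_fun setT f -> (forall x, 0 <= f x) -> measurable_fun setT (fun x => (f x)^-1).
Proof.
move=> mf f0; have -> : (fun x => (f x)^-1) = (fun x => f x `^ (-1)).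
  by apply/funext => x; rewrite powR_inv1.
exact: (measurableT_comp (measurable_powR _)).
Qed.

Lemma Rintegral_period_cosE (R : realType) (a : R) (k : int) :
  \int[@lebesgue_measure R]_(s in @period R) cos (a + k%:~R * s) =
  (k == 0)%:R * (2 * pi) * cos a.
Proof.
case: eqVneq => [->|k0]; last by rewrite Rintegral_period_cos// !mul0r.
under eq_Rintegral do rewrite mulr0z mul0r addr0.
rewrite Rintegral_cst; last exact: measurable_itv.
by rewrite [X in fine X]lebesgue_period mul1r mulrC.
Qed.

(** Product to sum. The frequency [q - p] may be negative, hence the integers; [q + p] vanishes only
    for [p = q = 0], whence the doubled value there. *)
Lemma Rintegral_period_cos_cos (R : realType) (a : R) (p q : nat) :
  \int[@lebesgue_measure R]_(s in @period R) (cos (p%:R * s) * cos (a + q%:R * s)) =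
  (q == p)%:R * ((q == 0)%N.+1%:R * pi) * cos a.
Proof.
have mp : measurable (@period R : set (measurableTypeR R)) by exact: measurable_itv.
have ic k : (@lebesgue_measure R).-integrable (@period R)
    (EFin \o (fun s => cos (a + k%:~R * s))).
  by apply: (@integrable_period _ _ 1) => [|t _]; [exact: measurable_cos_affine|exact: cos_max].
have E s : cos (p%:R * s) * cos (a + q%:R * s) =
    2^-1 * (cos (a + (q%:Z + p%:Z)%:~R * s) + cos (a + (q%:Z - p%:Z)%:~R * s)).
  rewrite rmorphB rmorphD/= mulrDl mulrBl !addrA.
  by move: (a + q%:R * s) => u; rewrite cosD cosB; field.
under eq_Rintegral do rewrite E.
rewrite RintegralZl//; last first.
  by apply: eq_integrable (integrableD mp (ic (q%:Z + p%:Z)) (ic (q%:Z - p%:Z))) => //.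
rewrite RintegralD//.
rewrite !Rintegral_period_cosE subr_eq0 !eqz_nat.
case: (eqVneq q p) => [->|qp]; last first.
  have -> : (q + p == 0)%N = false.
    by apply/negbTE; apply: contra qp; rewrite addn_eq0 => /andP[/eqP -> /eqP ->].
  by rewrite !mul0r addr0 mulr0.
by rewrite addnn double_eq0; case: eqP => _ /=; field.
Qed.

Section cosine_series.
Context {R : realType} (c : nat -> R) (S : R).
Hypothesis cS : forall P, \sum_(p < P) `|c p| <= S.
Local Notation leb := (@lebesgue_measure R).

Definition cos_part N (t : R) : R := \sum_(p < N) c p * cos (p%:R * t).
Definition cos_series t : R := limn (cos_part ^~ t).

Let A N : R := \sum_(p < N) `|c p|.
Let tail N : R := limn A - A N.

Let A_nd : nondecreasing_seq A.
Proof.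
apply/nondecreasing_seqP => n; rewrite /A big_ord_recr/= lerDl//.
Qed.

Let A_cvg : cvgn A.
Proof.
apply: nondecreasing_is_cvgn => //; exists S => _ [n _ <-]; exact: cS.
Qed.

Let tail_cvg : tail @ \oo --> (0 : R).
Proof. by rewrite /tail -(subrr (limn A)); apply: cvgB => //; exact: cvg_cst. Qed.

Let cos_part_tail t n k : (n <= k)%N -> `|cos_part k t - cos_part n t| <= tail n.
Proof.
move=> nk; apply: (@le_trans _ _ (A k - A n)); last first.
  by rewrite lerD2r; apply: nondecreasing_cvgn_le.
rewrite /cos_part /A -!(big_mkord xpredT (fun p => c p * cos (p%:R * t))).
rewrite -!(big_mkord xpredT (fun p => `|c p|)).
rewrite !(big_cat_nat (leq0n n) nk)/= [X in `|X|]addrAC subrr add0r addrAC subrr add0r.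
apply: (le_trans (ler_norm_sum _ _ _)); apply: ler_sum => p _.
by rewrite normrM ler_piMr// cos_max.
Qed.

Let cos_series_tail t n : `|cos_series t - cos_part n t| <= tail n.
Proof.
by have [_] := cvg_of_tail_bound (fun n k => @cos_part_tail t n k) tail_cvg; exact.
Qed.

Lemma cos_part_cvg t : cos_part ^~ t @ \oo --> cos_series t.
Proof. by have [] := cvg_of_tail_bound (fun n k => @cos_part_tail t n k) tail_cvg. Qed.

Lemma cos_series_approx (e : R) : 0 < e ->
  exists N, forall t, `|cos_series t - cos_part N.+1 t| <= e.
Proof.
move=> e0; have /cvgr0Pnorm_lt/(_ _ e0)[N _ /(_ N.+1 (leqnSn _))]/= := tail_cvg.
move=> /(le_lt_trans (ler_norm _))/ltW tN; exists N => t.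
exact: le_trans (cos_series_tail _ _) tN.
Qed.

Lemma cos_part_bound N t : `|cos_part N t| <= S.
Proof.
apply: (le_trans (ler_norm_sum _ _ _)); apply: le_trans (cS N).
by apply: ler_sum => p _; rewrite normrM ler_piMr// cos_max.
Qed.

Lemma cos_series_bound t : `|cos_series t| <= S.
Proof.
apply: (@cvgr_to_le _ \oo _ _ (fun N => `|cos_part N t|)).
  by apply: cvg_norm; exact: cos_part_cvg.
by apply: nearW => N; exact: cos_part_bound.
Qed.

Lemma measurable_cos_term (a k : R) : measurable_fun setT (fun s => a * cos (k * s)).
Proof.
have := measurable_cos_affine 0 k; under eq_fun do rewrite add0r.
by move=> mc; exact: measurable_funM.
Qed.

Lemma measurable_cos_part N : measurable_fun setT (cos_part N).
Proof. by apply: measurable_sum => p; exact: measurable_cos_term. Qed.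

Lemma measurable_cos_series : measurable_fun setT cos_series.
Proof.
apply: (measurable_fun_cvg measurable_cos_part) => t _; exact: cos_part_cvg.
Qed.

Let mp : measurable (@period R : set (measurableTypeR R)).
Proof. exact: measurable_itv. Qed.

Lemma integrable_cos_part N a q :
  leb.-integrable (@period R) (EFin \o (fun s => cos_part N s * cos (a + q%:R * s))).
Proof.
apply: (@integrable_period _ _ S) => [|t _].
  by apply: measurable_funM; [exact: measurable_cos_part|exact: measurable_cos_affine].
rewrite normrM (le_trans _ (cos_part_bound N t))// ler_piMr//; exact: cos_max.
Qed.

Lemma Rintegral_cos_part a q N :
  \int[leb]_(s in @period R) (cos_part N s * cos (a + q%:R * s)) =
  (q < N)%:R * (c q * ((q == 0)%N.+1%:R * pi) * cos a).
Proof.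
elim: N => [|N IH].
  rewrite mul0r; under eq_Rintegral do rewrite /cos_part big_ord0 mul0r.
  by rewrite Rintegral_cst// mul0r.
have ic : leb.-integrable (@period R)
    (EFin \o (fun s => cos (N%:R * s) * cos (a + q%:R * s))).
  apply: (@integrable_period _ _ 1) => [|t _].
    apply: measurable_funM; last exact: measurable_cos_affine.
    by have := measurable_cos_term 1 N%:R; under eq_fun do rewrite mul1r.
  by rewrite normrM mulr_ile1// cos_max.
under eq_Rintegral do rewrite /cos_part big_ord_recr/= mulrDl -mulrA.
rewrite RintegralD//; [|exact: integrable_cos_part|]; last first.
  exact: (integrableZl mp (c N) ic).
rewrite IH RintegralZl// Rintegral_period_cos_cos ltnS [in RHS]leq_eqVlt.
case: (eqVneq q N) => [->|qN] /=; first by rewrite ltnn mul0r add0r !mul1r mulrA.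
by rewrite !mul0r mulr0 addr0.
Qed.

(** Uniform convergence. Once [N > q] the partial sum already has the final integral, hence the
    shift by [q + 1]. *)
Lemma Rintegral_cos_series a q :
  \int[leb]_(s in @period R) (cos_series s * cos (a + q%:R * s)) =
  c q * ((q == 0)%N.+1%:R * pi) * cos a.
Proof.
have t0 : tail (n + q.+1)%N * (2 * pi) @[n --> \oo] --> (0 : R).
  by rewrite -(mul0r (2 * pi)); apply: cvgMl; rewrite (cvg_shiftn q.+1 tail).
apply: (eq_of_tail_bound _ t0) => n; set N := (n + q.+1)%N.
have -> : c q * ((q == 0)%N.+1%:R * pi) * cos a =
    \int[leb]_(s in @period R) (cos_part N s * cos (a + q%:R * s)).
  by rewrite Rintegral_cos_part /N addnS ltnS leq_addl mul1r.
rewrite -RintegralB//; last exact: integrable_cos_part; last first.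
  apply: (@integrable_period _ _ S) => [|t _].
    by apply: measurable_funM; [exact: measurable_cos_series|exact: measurable_cos_affine].
  rewrite normrM (le_trans _ (cos_series_bound t))// ler_piMr//; exact: cos_max.
apply: (@Rintegral_period_le _ _ _ 0) => [|t _ _].
  apply: measurable_funB; apply: measurable_funM;
    [exact: measurable_cos_series|exact: measurable_cos_affine|
     exact: measurable_cos_part|exact: measurable_cos_affine].
rewrite -mulrBl normrM (le_trans _ (cos_series_tail t N))// ler_piMr//; exact: cos_max.
Qed.

End cosine_series.

(** * The Neumann-Poincare operator on cosine series *)

Lemma Rintegral_period_sum (R : realType) (n : nat) (f : 'I_n -> R -> R) :
  (forall i, (@lebesgue_measure R).-integrable (@period R) (EFin \o f i)) ->
  \int[@lebesgue_measure R]_(s in @period R) (\sum_(i < n) f i s) =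
  \sum_(i < n) \int[@lebesgue_measure R]_(s in @period R) f i s.
Proof.
have mp : measurable (@period R : set (measurableTypeR R)) by exact: measurable_itv.
move=> fi; rewrite /Rintegral; under eq_integral do rewrite -sumEFin.
rewrite integral_sum// sum_fine// => i _.
by apply: integrable_fin_num => //; exact: fi.
Qed.

Lemma integrable_period_sum (R : realType) (n : nat) (f : 'I_n -> R -> R) :
  (forall i, (@lebesgue_measure R).-integrable (@period R) (EFin \o f i)) ->
  (@lebesgue_measure R).-integrable (@period R)
    (EFin \o (fun s => \sum_(i < n) f i s)).
Proof.
have mp : measurable (@period R : set (measurableTypeR R)) by exact: measurable_itv.
move=> fi; have -> : EFin \o (fun s => \sum_(i < n) f i s) =
    (fun s => \sum_(i < n) (f i s)%:E)%E.
  by apply/funext => s; rewrite /= sumEFin.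
by apply: integrable_sum => // i _; exact: fi.
Qed.

Section npm_eigenfunction.
Context {R : realType} (rho0 : R) (m : nat) (d B mu : R) (c : nat -> R).
Hypothesis hd : m%:R * `|d| <= 2^-1.
Hypothesis cB : forall p, `|c p| <= B.
Hypothesis mu0 : mu != 0.
Hypothesis npmc : forall p, npm m d c p = mu * c p.
Local Notation J := (J rho0 m d).
Local Notation sigma := (sigma rho0 m d).
Local Notation leb := (@lebesgue_measure R).

Let S : R := 2 * m%:R ^+ 2 * B / `|mu|.

(** Bootstrap: [c = mu^-1 B c] with [c] bounded, so [c] is summable. *)
Let cS P : \sum_(p < P) `|c p| <= S.
Proof.
rewrite ler_pdivlMr ?normr_gt0// mulr_suml.
have := npm_tail hd cB 0 P; rewrite expr0 mulr1; apply: le_trans.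
by apply: ler_sum => p _; rewrite npm_part0 subr0 npmc normrM mulrC.
Qed.

(** Row 0 of [B] vanishes because of the factor [p] in [grunsky]. This removes the constant part of
    the kernel and lets the cosine series start at [v_1]. *)
Lemma npm_eigen_c0 : c 0 = 0.
Proof.
have : npm m d c 0 = 0.
  apply/(cvg_lim (@Rhausdorff R)); have -> : (fun M => npm_part m d M c 0) = cst 0.
    apply/funext => M; rewrite /npm_part big1// => n _.
    by rewrite /grunsky !mul0r mulr0 mul0r.
  exact: cvg_cst.
by rewrite npmc => /eqP; rewrite mulf_eq0 (negbTE mu0)/= => /eqP.
Qed.

Let g := cos_series c.
Let phi t := g t / J t.

Let mg : measurable_fun setT g. Proof. exact: measurable_cos_series cS. Qed.

Let J0 t : 0 < J t. Proof. exact: J_gt0. Qed.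

Let JV t : (J t)^-1 <= 2 / expR rho0.
Proof.
have /andP[+ _] := J_bounds rho0 hd t; rewrite -invf_div => Jl.
by rewrite -[leRHS]invrK lef_pV2 ?posrE ?invr_gt0 ?divr_gt0 ?expR_gt0// ?invf_div// -invf_div.
Qed.

Let mJV : measurable_fun setT (fun t => (J t)^-1).
Proof.
by apply: measurable_fun_inv_ge0 => [|t]; [exact: measurable_J|exact: ltW].
Qed.

Let mphi : measurable_fun setT phi. Proof. exact: measurable_funM. Qed.

Let K t s := J t * NP_kernel (bdry rho0 m d) t s.

Let measurable_bdry : measurable_fun setT (fun s => (bdry rho0 m d s).1) /\
  measurable_fun setT (fun s => (bdry rho0 m d s).2).
Proof.
have mt : measurable_fun setT (fun s : R => m%:R * s) by exact: measurable_funM.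
split; apply: measurable_funM => //.
  apply: measurable_funD; first by apply: continuous_measurable_fun; exact: continuous_cos.
  apply: measurable_funM => //; apply: measurableT_comp => //.
  by apply: continuous_measurable_fun; exact: continuous_cos.
apply: measurable_funB; first by apply: continuous_measurable_fun; exact: continuous_sin.
apply: measurable_funM => //; apply: measurableT_comp => //.
by apply: continuous_measurable_fun; exact: continuous_sin.
Qed.

Let mK t : measurable_fun setT (NP_kernel (bdry rho0 m d) t).
Proof.
have [m1 m2] := measurable_bdry.
have w1 : measurable_fun setT (fun s => (bdry rho0 m d t).1 - (bdry rho0 m d s).1).
  exact: measurable_funB.
have w2 : measurable_fun setT (fun s => (bdry rho0 m d t).2 - (bdry rho0 m d s).2).
  exact: measurable_funB.
rewrite /NP_kernel/= /dotp; move: (outward_normal _ t) => n.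
set w := (fun s => _ - _) in w1; set w' := (fun s => _ - _) in w2.
change (measurable_fun setT (fun s => (w s * n.1 + w' s * n.2) *
  (w s * w s + w' s * w' s)^-1)).
move: w w' w1 w2 => w w' w1 w2.
apply: measurable_funM; first by apply: measurable_funD; exact: measurable_funM.
apply: measurable_fun_inv_ge0 => [|s]; last by rewrite -!expr2 addr_ge0 ?sqr_ge0.
by apply: measurable_funD; exact: measurable_funM.
Qed.

Lemma measurable_NP_partial M t : measurable_fun setT (NP_partial m d M t).
Proof.
apply: measurable_funD => //; apply: measurable_funM => //.
apply: measurable_sum => n; apply: measurable_funM => //.
apply: measurable_sum => p; apply: measurable_funM => //.
exact: measurable_cos_affine.
Qed.

Let cosg_int q a : leb.-integrable (@period R)
  (EFin \o (fun s => g s * cos (a + q%:R * s))).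
Proof.
apply: (@integrable_period _ _ S) => [|t _].
  by apply: measurable_funM => //; exact: measurable_cos_affine.
by rewrite normrM (le_trans _ (cos_series_bound cS t))// ler_piMr// cos_max.
Qed.

Lemma Rintegral_NP_partial M t :
  \int[leb]_(s in @period R) (NP_partial m d M t s * g s) =
  2 * pi * d * \sum_(p < (M * m).+1) npm_part m d M c p * cos (p%:R * t).
Proof.
have mp : measurable (@period R : set (measurableTypeR R)) by exact: measurable_itv.
pose f n p s := g s * cos (p%:R * t + (n.+1 * m.+1 - p)%:R * s).
pose F (n : 'I_M) s := \sum_(p < (M * m).+1) d ^+ n * grunsky m n p * f n p s.
have fi n p : leb.-integrable (@period R) (EFin \o (fun s => d ^+ n * grunsky m n p * f n p s)).
  by apply: (integrableZl mp _ (cosg_int _ _)).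
have Fi n : leb.-integrable (@period R) (EFin \o F n) by apply: integrable_period_sum.
(* The constant 1/2 is written with a cosine of frequency 0, so that its contribution is a multiple
   of [c 0]. *)
have E s : NP_partial m d M t s * g s =
    2^-1 * (g s * cos (0 + 0%:R * s)) + 2 * d * \sum_(n < M) F n s.
  rewrite mul0r addr0 cos0 mulr1 /NP_partial mulrDl; congr (_ + _).
  rewrite -mulrA; congr (_ * _); rewrite mulr_suml; apply: eq_bigr => n _.
  rewrite /F -mulrA mulr_suml mulr_sumr; apply: eq_bigr => p _.
  by rewrite /f; ring.
under eq_Rintegral do rewrite E.
have sFi : leb.-integrable (@period R) (EFin \o (fun s => \sum_(n < M) F n s)).
  exact: integrable_period_sum.
rewrite RintegralD//; [|exact: (integrableZl mp _ (cosg_int _ _))|exact: (integrableZl mp _ sFi)].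
rewrite !RintegralZl// (Rintegral_cos_series cS).
rewrite npm_eigen_c0 !mul0r mulr0 add0r Rintegral_period_sum//.
have -> : 2 * pi * d * \sum_(p < (M * m).+1) npm_part m d M c p * cos (p%:R * t) =
  2 * d * (pi * \sum_(p < (M * m).+1) npm_part m d M c p * cos (p%:R * t)) by ring.
congr (_ * _); rewrite mulr_sumr.
under [RHS]eq_bigr do rewrite /npm_part mulr_suml mulr_sumr.
rewrite exchange_big; apply: eq_bigr => n _ /=.
rewrite /F Rintegral_period_sum//; apply: eq_bigr => p _.
rewrite RintegralZl; [|exact: mp|exact: cosg_int].
rewrite /f (Rintegral_cos_series cS).
(* At index 0 the cosine integral has the extra factor 2, which is harmless as [c 0 = 0]. *)
case: (eqVneq (n.+1 * m.+1 - p)%N 0%N) => [->|_] /=; last by ring.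
by rewrite npm_eigen_c0 !(mul0r, mulr0).
Qed.

(** [mu * g] is the cosine series of [B c], and [npm_part] of order [M] is supported on [p <= M m],
    so the l1 tail estimate applies. *)
Lemma npm_cos_series M t :
  `|mu * g t - \sum_(p < (M * m).+1) npm_part m d M c p * cos (p%:R * t)| <=
  2 * m%:R ^+ 2 * B * (m%:R * `|d|) ^+ M.
Proof.
set s := \sum_(p < _) _.
apply: (@cvgr_to_le _ \oo _ _ (fun P => `|mu * cos_part c P t - s|)).
  apply: cvg_norm; apply: cvgB; last exact: cvg_cst.
  by apply: cvgMr; exact: (cos_part_cvg cS).
exists (M * m).+1 => // P /= MP; apply: le_trans (npm_tail hd cB M P).
have -> : s = \sum_(p < P) npm_part m d M c p * cos (p%:R * t).
  rewrite /s (big_ord_widen _ (fun p => npm_part m d M c p * cos (p%:R * t)) MP).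
  rewrite [RHS](bigID (fun p : 'I_P => (p < (M * m).+1)%N))/= [X in _ + X]big1 ?addr0//.
  move=> p; rewrite ltnS -ltnNge => Mp; rewrite /npm_part big1 ?mul0r// => n _.
  rewrite grunsky_eq0 ?mulr0 ?mul0r// (leq_ltn_trans _ Mp)// leq_mul2r.
  by rewrite ltn_ord orbT.
rewrite /cos_part mulr_sumr -sumrB; apply: (le_trans (ler_norm_sum _ _ _)).
apply: ler_sum => p _; rewrite npmc mulrA -mulrBl normrM ler_piMr//; exact: cos_max.
Qed.

(** After multiplication by [2 * pi * J t], both sides are compared with the integral of the
    truncated kernel against [g]; the equality follows as [M] grows. *)
Lemma NP_cos_series t : period t -> NP rho0 m d phi t = d * mu * phi t.
Proof.
move=> pt; have -> : NP rho0 m d phi t = (2 * pi)^-1 *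
    \int[leb]_(s in @period R) (NP_kernel (bdry rho0 m d) t s * g s).
  rewrite /NP Rintegral_sigma; last exact: measurable_funM.
  congr (_ * _); apply: eq_Rintegral => s _.
  by rewrite /phi -mulrA divfK// gt_eqF.
have pi20 : 2 * pi != 0 :> R by rewrite mulf_neq0 ?gt_eqF ?pi_gt0.
apply: (mulfI (_ : 2 * pi * J t != 0)); first by rewrite mulf_neq0// gt_eqF.
have -> : 2 * pi * J t * ((2 * pi)^-1 *
    \int[leb]_(s in @period R) (NP_kernel (bdry rho0 m d) t s * g s)) =
    J t * \int[leb]_(s in @period R) (NP_kernel (bdry rho0 m d) t s * g s).
  by rewrite mulrCA -[2 * pi * J t * _]mulrA mulKf.
have -> : 2 * pi * J t * (d * mu * phi t) = 2 * pi * d * (mu * g t).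
  by rewrite /phi; field; rewrite gt_eqF.
pose x : R := m%:R * `|d|.
(* First the error from truncating the kernel, then the error from truncating [B c]. *)
pose b M := 2 * `|d| * m%:R ^+ 2 * x ^+ M * S * (2 * pi) +
  `|2 * pi * d| * (2 * m%:R ^+ 2 * B * x ^+ M).
have b0 : b @ \oo --> (0 : R).
  have -> : b = fun M => (2 * `|d| * m%:R ^+ 2 * S * (2 * pi) +
      `|2 * pi * d| * (2 * m%:R ^+ 2 * B)) * x ^+ M.
    by apply/funext => M; rewrite /b; ring.
  rewrite -(mulr0 (2 * `|d| * m%:R ^+ 2 * S * (2 * pi) +
      `|2 * pi * d| * (2 * m%:R ^+ 2 * B))).
  apply: cvgMr; apply: cvg_expr; rewrite ger0_norm ?mulr_ge0//.
  by rewrite (le_lt_trans hd)// invf_lt1// ltr1n.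
have mp : measurable (@period R : set (measurableTypeR R)) by exact: measurable_itv.
apply: (eq_of_tail_bound _ b0) => M.
have NPb : exists C, forall s, `|NP_partial m d M t s| <= C.
  exists (`|2^-1| + `|2 * d| * \sum_(n < M) `|d ^+ n| * \sum_(p < (M * m).+1) `|grunsky m n p|) => s.
  rewrite (le_trans (ler_normD _ _))// lerD2l normrM ler_wpM2l//.
  apply: (le_trans (ler_norm_sum _ _ _)); apply: ler_sum => n _.
  rewrite normrM ler_wpM2l//; apply: (le_trans (ler_norm_sum _ _ _)); apply: ler_sum => p _.
  by rewrite normrM ler_piMr// cos_max.
have [C NPC] := NPb.
pose e : R := 2 * `|d| * m%:R ^+ 2 * x ^+ M.
have Ke s : s != t -> period s -> `|K t s - NP_partial m d M t s| <= e.
  move=> st ps; apply: NP_kernel_expansion => //; apply: contra_neq st => cts.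
  apply/eqP; rewrite -subr_eq0; apply/eqP; apply: cis_eq_small.
    move: pt ps; rewrite /period/= !in_itv/= => /andP[t0 t1] /andP[s0 s1].
    by rewrite ltr_norml; apply/andP; split; lra.
  by rewrite cisD cisN cts mulfV// cis_neq0.
have iP : leb.-integrable (@period R) (EFin \o (fun s => NP_partial m d M t s * g s)).
  apply: (@integrable_period _ _ (C * S)) => [|s _].
    by apply: measurable_funM => //; exact: measurable_NP_partial.
  by rewrite normrM ler_pM// (cos_series_bound cS).
have mKg : measurable_fun setT (fun s => NP_kernel (bdry rho0 m d) t s * g s).
  exact: measurable_funM.
have iK : leb.-integrable (@period R)
    (EFin \o (fun s => NP_kernel (bdry rho0 m d) t s * g s)).
  (* The expansion says nothing at [s = t]; there the kernel is 0 by division by zero. *)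
  have Ct : `|NP_kernel (bdry rho0 m d) t t| = 0.
    by rewrite /NP_kernel /dotp/= !subrr !mul0r addr0 mul0r normr0.
  have e0 : 0 <= e by rewrite !mulr_ge0// ?exprn_ge0// mulr_ge0.
  apply: (@integrable_period _ _ ((e + C) / J t * S)) => [//|s ps].
  rewrite normrM ler_pM// ?(cos_series_bound cS)//.
  have [->|st] := eqVneq s t.
    by rewrite Ct divr_ge0 ?addr_ge0 ?(le_trans _ (NPC 0))// ltW.
  rewrite ler_pdivlMr// mulrC -[X in X * _](gtr0_norm (J0 t)) -normrM -/(K t s).
  rewrite -(subrK (NP_partial m d M t s) (K t s)) (le_trans (ler_normD _ _))// lerD//.
  exact: Ke.
have hb : `|J t * \int[leb]_(s in @period R) (NP_kernel (bdry rho0 m d) t s * g s) -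
   \int[leb]_(s in @period R) (NP_partial m d M t s * g s)| <= e * S * (2 * pi).
  rewrite -RintegralZl// -RintegralB//; last exact: (integrableZl mp _ iK).
  apply: (@Rintegral_period_le _ _ _ t) => [|s ps st].
    apply: measurable_funB; apply: measurable_funM => //.
    exact: measurable_NP_partial.
  rewrite mulrA -/(K t s) -mulrBl normrM ler_pM// ?(cos_series_bound cS)//.
  exact: Ke.
rewrite -(subrK (\int[leb]_(s in @period R) (NP_partial m d M t s * g s)) (J t * _)).
rewrite -addrA (le_trans (ler_normD _ _))// lerD//.
rewrite Rintegral_NP_partial -mulrBr normrM ler_wpM2l// distrC.
exact: npm_cos_series.
Qed.

Let L2norm_div_J (f : R -> R) (e : R) : measurable_fun setT f ->
  (forall t, `|f t| <= e) ->
  (L2norm rho0 m d (fun t => (J t)^-1 * f t)%R <= (e * (2 / expR rho0) * L2const rho0)%:E)%E.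
Proof.
move=> mf fe; apply: L2norm_bounded => // [|t]; first exact: measurable_funM.
rewrite normrM mulrC ler_pM// ger0_norm; first exact: JV.
by rewrite invr_ge0 ltW.
Qed.

Let phiE : phi = fun t => (J t)^-1 * g t.
Proof. by apply/funext => t; rewrite mulrC. Qed.

Lemma cos_series_Vc : phi \in Vc rho0 m d.
Proof.
rewrite inE /Vc/=; split.
  rewrite inE; apply/andP; split; rewrite inE/=; first exact: mphi.
  rewrite /finite_norm phiE.
  apply: le_lt_trans (L2norm_div_J mg (cos_series_bound cS)) _.
  exact: ltry.
move=> eps eps0; pose L := 2 / expR rho0 * L2const rho0.
have L0 : 0 <= L by rewrite mulr_ge0 ?sqrtr_ge0// divr_ge0// expR_ge0.
have e0 : 0 < eps / (L + 1) by rewrite divr_gt0// ltr_wpDl.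
have [N hN] := cos_series_approx cS e0.
exists N, c.
have -> : (fun t => phi t - \sum_(1 <= n < N.+1) c n * vc rho0 m d n t) =
    (fun t => (J t)^-1 * (g t - cos_part c N.+1 t)).
  apply/funext => t; rewrite phiE mulrBr; congr (_ - _).
  rewrite /cos_part -(big_mkord xpredT (fun p => c p * cos (p%:R * t))).
  rewrite big_ltn// npm_eigen_c0 mul0r add0r mulr_sumr; apply: eq_bigr => n _.
  by rewrite /vc mulrCA.
apply: le_lt_trans (L2norm_div_J _ hN) _.
  by apply: measurable_funB => //; exact: measurable_cos_part.
rewrite lte_fin -mulrA -/L mulrAC ltr_pdivrMr ?ltr_wpDl//.
by rewrite ltr_pM2l// ltrDl.
Qed.

(** If [phi] vanished almost everywhere, so would its integral against [cos (j s)]; the density [J]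
    cancels the denominator of [phi], leaving [pi * c j]. *)
Lemma cos_series_L2norm_neq0 j : (0 < j)%N -> c j != 0 -> L2norm rho0 m d phi != 0%E.
Proof.
move=> j0; apply: contra_neq => phi0.
have mphiE : measurable_fun setT (EFin \o phi) by exact/measurable_EFinP.
have /Lnorm_eq0_eq0 := phi0; move=> /(_ mphiE) ae0.
have /ae0 {}ae0 : (0 < 2%:E :> \bar R)%E by rewrite lte_fin.
have mc : measurable_fun setT (fun s : R => cos (0 + j%:R * s)) by exact: measurable_cos_affine.
have : \int[sigma]_s (phi s * cos (0 + j%:R * s)) = 0.
  rewrite /Rintegral; have -> : (\int[sigma]_s (phi s * cos (0 + j%:R * s))%:E = \int[sigma]_s 0)%E.
    apply: ae_eq_integral => //.
      by apply/measurable_EFinP; exact: measurable_funM.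
    move: ae0; apply: filterS => s /= /(_ I) [->] _. by rewrite mul0r.
  by rewrite integral0.
rewrite Rintegral_sigma; last exact: measurable_funM.
under eq_Rintegral do rewrite /phi mulrAC divfK ?gt_eqF//.
rewrite (Rintegral_cos_series cS) cos0 mulr1 => /eqP.
by rewrite mulf_eq0 mulf_eq0 pnatr_eq0/= (gt_eqF (pi_gt0 _)) orbF => /eqP.
Qed.

Lemma cos_series_L2norm_dist (e a b : R) (j k : nat) :
  (forall P, \sum_(p < P) `|c p - (a * (nat_of_ord p == j)%:R + b * (nat_of_ord p == k)%:R)| <= e) ->
  (L2norm rho0 m d (fun t => phi t - (a * vc rho0 m d j t + b * vc rho0 m d k t))%R <=
    (e * (2 / expR rho0) * L2const rho0)%:E)%E.
Proof.
move=> he; have -> : (fun t => phi t - (a * vc rho0 m d j t + b * vc rho0 m d k t)) =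
    (fun t => (J t)^-1 * (g t - (a * cos (j%:R * t) + b * cos (k%:R * t)))).
  by apply/funext => t; rewrite phiE /vc; ring.
apply: L2norm_div_J => [|t].
  apply: measurable_funB => //; apply: measurable_funD; exact: measurable_cos_term.
apply: (@cvgr_to_le _ \oo _ _
    (fun P => `|cos_part c P t - (a * cos (j%:R * t) + b * cos (k%:R * t))|)).
  by apply: cvg_norm; apply: cvgB; [exact: cos_part_cvg cS _|exact: cvg_cst].
(* From here on the finite sums contain both indices [j] and [k]. *)
exists (maxn j k).+1 => // P /=; rewrite gtn_max => /andP[jP kP].
have dE i (iP : (i < P)%N) (x : R) :
    x * cos (i%:R * t) = \sum_(p < P) x * (nat_of_ord p == i)%:R * cos (p%:R * t).
  rewrite (bigD1 (Ordinal iP))//= eqxx mulr1 big1 ?addr0// => p.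
  by rewrite -val_eqE/= => /negbTE ->; rewrite mulr0 mul0r.
rewrite (dE _ jP) (dE _ kP) -big_split/= /cos_part -sumrB.
apply: (le_trans (ler_norm_sum _ _ _)); apply: le_trans (he P); apply: ler_sum => p _.
by rewrite -mulrDl -mulrBl normrM ler_piMr// cos_max.
Qed.

End npm_eigenfunction.

(** * Eigenpairs of the operator and their expansions *)

Lemma npm_scale (R : realType) (m : nat) (d r C : R) (u : nat -> R) p :
  m%:R * `|d| <= 2^-1 -> (forall p, `|u p| <= C) ->
  npm m d (fun p => r * u p) p = r * npm m d u p.
Proof.
move=> hd uC; have := npm_linear r 0 hd uC uC p; rewrite mul0r addr0 => <-.
by congr npm; apply/funext => q; rewrite mul0r addr0.
Qed.

(* The case j = k, + sign (b = false), with r = 1 / (2 sqrt k), is the simple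
   middle eigenvalue for odd m. *)
Lemma eigen_expansion_pair (R : realType) (m : nat) (rho0 r : R) (j k : nat) (b : bool) :
  (0 < j)%N -> (0 < k)%N -> (j + k = m.+1)%N -> (j != k) || ~~ b -> r != 0 ->
  has_eigen_expansion rho0 m ((-1) ^+ b * (Num.sqrt (j%:R * k%:R) / 2))
    (fun d t => r * (Num.sqrt j%:R * vc rho0 m d j t +
      (-1) ^+ b * (Num.sqrt k%:R * vc rho0 m d k t))).
Proof.
move=> j0 k0 jk jkb r0; have [Cst nearC] := npm_eigenvector R b j0 k0 jk.
set al := _ * (_ / 2); pose a : R := r * Num.sqrt j%:R.
pose b' : R := r * ((-1) ^+ b * Num.sqrt k%:R).
pose L : R := 2 / expR rho0 * L2const rho0.
(* Limit of the coefficient [c j]; for [j = k] both terms contribute to it, which is why the minus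
   sign is then excluded. *)
pose wj : R := Num.sqrt j%:R + (-1) ^+ b * (Num.sqrt k%:R * (j == k)%:R).
have wj0 : wj != 0.
  rewrite /wj; case: (eqVneq j k) jkb => [<-|_ _] /=.
    by case: b {nearC al b' wj} => // _; rewrite expr0 mul1r mulr1 gt_eqF// addr_gt0// sqrtr_gt0 ltr0n.
  by rewrite !mulr0 addr0 gt_eqF// sqrtr_gt0 ltr0n.
pose Cst' := Cst + `|r| * Cst * L.
pose Q (d : R) (x : R * (R -> R)) := [/\ NP_eigenpair rho0 m d x.1 x.2,
  `|x.1 - al * d| <= Cst' * d ^+ 2 &
  (L2norm rho0 m d (fun t => x.2 t - r * (Num.sqrt j%:R * vc rho0 m d j t +
      (-1) ^+ b * (Num.sqrt k%:R * vc rho0 m d k t)))%R <= (Cst' * `|d|)%:E)%E].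
(* The eigenpair must be a function of all [d] but exists only for small ones; choice is applied
   with a dummy value elsewhere. *)
have hQ d : exists y, (exists x, Q d x) -> Q d y.
  have [[x Qx]|nQ] := pselect (exists x, Q d x); first by exists x.
  by exists (0, fun=> 0) => /nQ.
have [F FQ] := boolp.choice hQ.
exists (fun d => (F d).1), (fun d => (F d).2), Cst'.
suff : \forall d \near (0 : R), exists x, Q d x by apply: filterS => d /FQ.
have hd1 : \forall d \near (0 : R), m%:R * `|d| <= 2^-1 by exact: near0_mulr_norm_le.
(* Keeps [c j] within [|wj| / 2] of [wj], hence nonzero. The absolute value is taken because the
   sign of [Cst] is unknown. *)
have hd2 : \forall d \near (0 : R), `|Cst| * `|d| <= `|wj| / 2.
  by apply: near0_mulr_norm_le => //; rewrite divr_gt0// normr_gt0.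
near=> d.
have hd : m%:R * `|d| <= 2^-1 by near: d.
have hw : `|Cst| * `|d| <= `|wj| / 2 by near: d.
have [mu [c [B [cB mu0 npmc muE cE]]]] : exists (mu : R) (c : nat -> R) (B : R),
    [/\ forall p, `|c p| <= B, mu != 0, forall p, npm m d c p = mu * c p,
        `|mu - (-1) ^+ b * (Num.sqrt (j%:R * k%:R) / 2)| <= Cst * `|d| &
        forall P, \sum_(p < P) `|c p - (Num.sqrt j%:R * (nat_of_ord p == j)%:R +
            (-1) ^+ b * (Num.sqrt k%:R * (nat_of_ord p == k)%:R))| <= Cst * `|d|].
  by near: d.
have Cd0 : 0 <= Cst * `|d| by apply: le_trans muE.
have L0 : 0 <= L by rewrite mulr_ge0 ?sqrtr_ge0// divr_ge0// expR_ge0.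
have Cd : Cst * `|d| <= Cst' * `|d|.
  rewrite /Cst' mulrDl lerDl (_ : _ * `|d| = `|r| * L * (Cst * `|d|)); last by ring.
  by rewrite mulr_ge0// mulr_ge0.
have cj0 : c j != 0.
  have : `|c j - wj| <= Cst * `|d|.
    apply: le_trans (cE j.+1); rewrite big_ord_recr/= eqxx mulr1 lerDr sumr_ge0//.
  move=> cw; apply: contraTneq cw => ->; rewrite sub0r normrN -ltNge.
  rewrite (le_lt_trans (ler_wpM2r _ (ler_norm Cst)))// (le_lt_trans hw)//.
  by rewrite ltr_pdivrMr// ltr_pMr ?normr_gt0// ltr1n.
pose c' p := r * c p.
have cB' p : `|c' p| <= `|r| * B by rewrite normrM ler_wpM2l.
have npmc' p : npm m d c' p = mu * c' p by rewrite (npm_scale _ _ hd cB) npmc mulrCA.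
have dd : `|d| * `|d| = d ^+ 2 by rewrite -normrM -expr2 ger0_norm// sqr_ge0.
exists (d * mu, fun t => cos_series c' t / J rho0 m d t); split => /=.
- split.
  + exact: cos_series_Vc hd cB' mu0 npmc'.
  + have c'j0 : c' j != 0 by rewrite mulf_neq0.
    exact: (@cos_series_L2norm_neq0 _ rho0 _ _ _ _ _ hd cB' mu0 npmc' _ j0 c'j0).
  (* The eigenvalue equation holds at every point of the period; its complement is [sigma]-null. *)
  + exists (~` @period R); split.
    * by apply: measurableC; exact: measurable_itv.
    * by rewrite /sigma/= /Defs.sigma setICl integral_set0.
    * move=> t /= nNP pt; apply: nNP.
      exact: (@NP_cos_series _ rho0 _ _ _ _ _ hd cB' mu0 npmc' _ pt).
- rewrite [al * d]mulrC -mulrBr normrM mulrC -dd mulrA ler_wpM2r//.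
  by rewrite (le_trans muE)// Cd.
- have E : (fun t => cos_series c' t / J rho0 m d t - r * (Num.sqrt j%:R * vc rho0 m d j t +
      (-1) ^+ b * (Num.sqrt k%:R * vc rho0 m d k t))) =
    (fun t => cos_series c' t / J rho0 m d t - (a * vc rho0 m d j t + b' * vc rho0 m d k t)).
    by apply/funext => t; rewrite /a /b'; ring.
  rewrite E; apply: le_trans
    (@cos_series_L2norm_dist _ rho0 _ _ _ _ _ hd cB' mu0 npmc' (`|r| * (Cst * `|d|)) _ _ _ _ _) _.
    move=> P; apply: le_trans (_ : `|r| * _ <= _); last by apply: ler_wpM2l; [|exact: cE].
    rewrite mulr_sumr; apply: ler_sum => p _; rewrite -normrM /c' /a /b'.
    by rewrite le_eqVlt; apply/orP; left; apply/eqP; congr `| _ |; ring.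
  rewrite lee_fin -mulrA -/L.
  have -> : `|r| * (Cst * `|d|) * L = Cst' * `|d| - Cst * `|d| by rewrite /Cst'; ring.
  by rewrite gerBl.
Unshelve. all: by end_near. Qed.

Theorem theorem2p2 (R : realType) (m : nat) (rho0 : R)
    (hm : (1 <= m)%N) (hrho0 : 0 < rho0) :
  (forall k : nat, m = (2 * k - 1)%N ->
     has_eigen_expansion rho0 m (k%:R / 2) (fun d t => vc rho0 m d k t) /\
     (forall (j : nat) (b : bool), (1 <= j <= k - 1)%N ->
        has_eigen_expansion rho0 m
          ((-1) ^+ b * (Num.sqrt (j%:R * (m + 1 - j)%:R) / 2))
          (fun d t => Num.sqrt j%:R * vc rho0 m d j t
             + (-1) ^+ b * (Num.sqrt (m + 1 - j)%:R
                              * vc rho0 m d (m + 1 - j) t)))) /\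
  (forall k : nat, m = (2 * k)%N ->
     forall (j : nat) (b : bool), (1 <= j <= k)%N ->
        has_eigen_expansion rho0 m
          ((-1) ^+ b * (Num.sqrt (j%:R * (m + 1 - j)%:R) / 2))
          (fun d t => Num.sqrt j%:R * vc rho0 m d j t
             + (-1) ^+ b * (Num.sqrt (m + 1 - j)%:R
                              * vc rho0 m d (m + 1 - j) t))).
Proof.
(* Parity only decides whether [j = m + 1 - j] has a solution; away from it both cases are the same
   statement, with [r = 1]. *)
have pair (j : nat) (b : bool) : (0 < j)%N -> (0 < m + 1 - j)%N -> (j != m + 1 - j)%N ->
    has_eigen_expansion rho0 m
      ((-1) ^+ b * (Num.sqrt (j%:R * (m + 1 - j)%:R) / 2))
      (fun d t => Num.sqrt j%:R * vc rho0 m d j t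
         + (-1) ^+ b * (Num.sqrt (m + 1 - j)%:R * vc rho0 m d (m + 1 - j) t)).
  move=> j0 k0 jk.
  have jkm : (j + (m + 1 - j) = m.+1)%N by lia.
  have jkb : (j != m + 1 - j)%N || ~~ b by rewrite jk.
  have := eigen_expansion_pair rho0 j0 k0 jkm jkb (oner_neq0 R).
  by under eq_fun do under eq_fun do rewrite mul1r.
split=> k mk.
  split=> [|j b /andP[j1 jk]]; last by apply: pair; lia.
  have k0 : (0 < k)%N by lia.
  have kk : (k + k = m.+1)%N by lia.
  have sk0 : Num.sqrt k%:R != 0 :> R by rewrite gt_eqF// sqrtr_gt0 ltr0n.
  have r0 : (2 * Num.sqrt k%:R)^-1 != 0 :> R by rewrite invr_neq0// mulf_neq0.
  have := @eigen_expansion_pair R m rho0 _ k k false k0 k0 kk (orbT _) r0.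
  rewrite expr0 mul1r -expr2 sqrtr_sqr ger0_norm//.
  suff -> : (fun d t => (2 * Num.sqrt k%:R)^-1 * (Num.sqrt k%:R * vc rho0 m d k t +
      1 * (Num.sqrt k%:R * vc rho0 m d k t))) = (fun d t => vc rho0 m d k t) by [].
  by apply/funext => d; apply/funext => t; field.
by move=> j b /andP[j1 jk]; apply: pair; lia.
Qed.
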